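(* Let $t\ge 0$ be an integer and let $f_0,\dots,f_t\colon \mathbb{Z}_{\ge 0}\to\mathbb{R}$ be a central moment function sequence (CMFS). Suppose that for all integers $d\ge 0$ and all $0\le k\le t$, \[ \mathbb{E}\Big[\big(\mathcal{X}_d-\tfrac d2\big)^k\Big]\le f_k(d). \] Then for every (loopless) matroid $\mathrm{M}$ of rank $d+1$, \[ \mathbb{E}\Big[\big(\mathcal{X}_{\mathrm{M}}-\tfrac d2\big)^t\Big]\le f_t(d). \]
   Context: All matroids are loopless. For a matroid $\mathrm{M}$ on ground set $E$, its Chow ring is $A^*(\mathrm{M})=\mathbb{Z}[x_F : F \text{ a nonempty proper flat}]/(I+J)$, where $I$ is generated by $x_Fx_G$ for incomparable flats $F,G$ and $J$ by $\sum_{F\ni i}x_F-\sum_{F\ni j}x_F$ for $i,j\in E$; it is graded by degree. If $\mathrm{M}$ has rank $d+1$, write $a_k(\mathrm{M})=\dim_{\mathbb{Q}}A^k(\mathrm{M})\otimes\mathbb{Q}$ ($0\le k\le d$) and let the Chow polynomial be $\underline{H}_{\mathrm{M}}(x)=\sum_k a_k(\mathrm{M})x^k$. The random variable $\mathcal{X}_{\mathrm{M}}$ takes value $k\in\{0,\dots,d\}$ with probability $a_k(\mathrm{M})/\sum_{i=0}^d a_i(\mathrm{M})$. $\mathcal{X}_d$ denotes $\mathcal{X}_{\mathrm{U}_{d+1}}$ for the Boolean matroid $\mathrm{U}_{d+1}$ on $d+1$ elements. A sequence of functions $f_0,\dots,f_t\colon\mathbb{Z}_{\ge0}\to\mathbb{R}$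 with $f_0\equiv 1$ is a CMFS if for all integers $a,b\ge0$ and all $0\le k\le t$: $f_k(a+b+2)\ge\sum_{i+j=k}\binom{k}{i}f_i(a)f_j(b)$. *)

(* Defs.v *)
From HB Require Import structures.
From mathcomp Require Import all_boot all_order all_algebra.
From mathcomp Require Import mpoly.
Set Implicit Arguments. Unset Strict Implicit. Unset Printing Implicit Defensive.
Import Order.TTheory GRing.Theory Num.Theory.
Local Open Scope ring_scope.

Definition is_matroid (n : nat) (r : {set 'I_n} -> nat) : Prop :=
  [/\ forall A : {set 'I_n}, (r A <= #|A|)%N,
      forall A B : {set 'I_n}, A \subset B -> (r A <= r B)%N
    & forall A B : {set 'I_n}, (r (A :|: B) + r (A :&: B) <= r A + r B)%N].

Definition loopless (n : nat) (r : {set 'I_n} -> nat) : Prop :=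
  forall i : 'I_n, r [set i] = 1%N.

Definition is_flat (n : nat) (r : {set 'I_n} -> nat) (S : {set 'I_n}) : bool :=
  [forall x, (x \notin S) ==> (r S < r (x |: S))%N].

Definition npflat (n : nat) (r : {set 'I_n} -> nat) (S : {set 'I_n}) : bool :=
  [&& is_flat r S, S != set0 & S != setT].

Section Chow.
Variables (n : nat) (r : {set 'I_n} -> nat).

Definition NPF := {S : {set 'I_n} | npflat r S}.
Definition nvar := #|{: NPF}|.

Definition xF (F : NPF) : {mpoly rat[nvar]} := 'X_(enum_rank F).

Definition incomparable (F G : NPF) : bool :=
  ~~ (val F \subset val G) && ~~ (val G \subset val F).

(* Spanning set of the degree-k part of the homogeneous ideal I + J:
   generators of I (degree 2) and of J (degree 1) times monomials of the
   complementary degree. *)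
Definition chow_gen (k : nat)
  (g : ('X_{1..nvar < k.+1} * NPF * NPF) + ('X_{1..nvar < k.+1} * 'I_n * 'I_n))
  : {mpoly rat[nvar]} :=
  match g with
  | inl (m, F, G) =>
      if (mdeg m + 2 == k)%N && incomparable F G
      then 'X_[(m : 'X_{1..nvar})] * xF F * xF G else 0
  | inr (m, i, j) =>
      if (mdeg m + 1 == k)%N
      then 'X_[(m : 'X_{1..nvar})] *
           (\sum_(F : NPF | i \in val F) xF F - \sum_(F : NPF | j \in val F) xF F)
      else 0
  end.

Definition chow_gen_idx (k : nat) : finType :=
  (('X_{1..nvar < k.+1} * NPF * NPF) + ('X_{1..nvar < k.+1} * 'I_n * 'I_n))%type.

Definition chow_gen_mx (k : nat) :
  'M[rat]_(#|{: chow_gen_idx k}|, #|{: 'X_{1..nvar < k.+1}}|) :=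
  \matrix_(g, j) (chow_gen (@enum_val (chow_gen_idx k) predT g))@_(bmnm (@enum_val 'X_{1..nvar < k.+1} predT j)).

(* a_k(M) = dim_Q A^k(M) (x) Q
          = #(degree-k monomials) - dim_Q (I+J)_k *)
Definition chow_dim (k : nat) : nat :=
  (#|[pred m : 'X_{1..nvar < k.+1} | mdeg m == k]| - \rank (chow_gen_mx k))%N.

End Chow.

(* E[(X_M - d/2)^k] for a matroid of rank d+1 *)
Definition chow_moment (R : realFieldType) (n : nat) (r : {set 'I_n} -> nat)
  (d k : nat) : R :=
  (\sum_(i < d.+1) (chow_dim r i)%:R * ((i%:R - d%:R / 2) ^+ k))
  / (\sum_(i < d.+1) (chow_dim r i)%:R).

Definition boolean_rank (d : nat) : {set 'I_d.+1} -> nat := fun A => #|A|.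

Definition boolean_moment (R : realFieldType) (d k : nat) : R :=
  @chow_moment R _ (@boolean_rank d) d k.

Definition CMFS (R : realFieldType) (t : nat) (f : nat -> nat -> R) : Prop :=
  (forall a, f 0%N a = 1) /\
  forall a b k, (k <= t)%N ->
    \sum_(i < k.+1) ('C(k, i))%:R * f i a * f (k - i)%N b <= f k (a + b + 2)%N.

(* Main.v *)
Require Import Defs.
From HB Require Import structures.
From mathcomp Require Import all_boot all_order all_algebra.
From mathcomp Require Import mpoly zify ring.
Set Implicit Arguments. Unset Strict Implicit. Unset Printing Implicit Defensive.
Import Order.TTheory GRing.Theory Num.Theory.
Local Open Scope ring_scope.

(** Write [H_M] for the Chow polynomial.  The degree [k] part of the Chow ring has a
    basis of Feichtner-Yuzvinsky monomials.  Dually, the linear functionals killing the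
    ideal can be prescribed freely on these monomials: add the flats one at a time, from
    the largest down.  Adding the variable [x] of a minimal flat [F] amounts to reducing
    polynomials in [x] modulo the monic polynomial [(x + h) ^ rk F], where [h] is the sum
    of the variables of the flats above [F]; the constant coefficient of the remainder is
    fed to a functional for the previous flats and the other coefficients to functionals
    for [M / F].  Counting monomials gives
      [sum_F (x ^ rk F - x) H_(M / F) = 1 - x]
    and this recursion yields, by induction, the deletion formula
      [H_M = H_(M \ i) + x sum_G H_(M | G) H_(M / (G + i))]
    over the nonempty flats [G] avoiding [i] such that [G + i] is a flat.  When [i] is
    not a coloop, every summand is centred at [d / 2], so [X_M] is a mixture of
    [X_(M \ i)] and of sums of independent variables attached to smaller matroids, which
    is what the CMFS inequality controls.  The odd central moments vanish and the even ones are
    nonnegative, so bounds on the factors may be multiplied.  Deleting non-coloops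
    ends with a Boolean matroid. *)

(** * Ranks, flats and closure *)

Section Matroid.
Variables (n : nat) (r : {set 'I_n} -> nat).
Hypothesis rM : is_matroid r.
Implicit Types A B C E F G H : {set 'I_n}.

Lemma rank_mono A B : A \subset B -> (r A <= r B)%N.
Proof. by case: rM => _ + _; apply. Qed.

Lemma rank_submod A B : (r (A :|: B) + r (A :&: B) <= r A + r B)%N.
Proof. by case: rM. Qed.

Lemma rank_set0 : r set0 = 0%N.
Proof. by case: rM => /(_ set0); rewrite cards0 leqn0 => /eqP. Qed.

Lemma rank_setU1 i A : (r (i |: A) <= (r A).+1)%N.
Proof.
have := rank_submod [set i] A; case: rM => /(_ [set i]); rewrite cards1 => *.
lia.
Qed.

(** Submodularity for [B] and [A :|: D]: their intersection contains [A], so its rank is at least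
    [r A = r B]. *)
Lemma rank_setU_eq A B D : A \subset B -> r A = r B -> r (A :|: D) = r (B :|: D).
Proof.
move=> AB rAB; apply/eqP; rewrite eqn_leq rank_mono ?setSU //=.
have := rank_submod B (A :|: D).
rewrite setUA (setUidPl AB).
have: (r A <= r (B :&: (A :|: D)))%N by rewrite rank_mono // subsetI AB subsetUl.
lia.
Qed.

(** Flats of the restriction to [E]. Keeping the one rank function [r] lets every minor be given by
    a pair of sets instead of a new matroid. *)
Definition flat_in E F :=
  (F \subset E) && [forall x in E :\: F, r F < r (x |: F)]%N.

Lemma flat_inP E F :
  reflect (F \subset E /\ forall x, x \in E -> x \notin F -> (r F < r (x |: F))%N)
          (flat_in E F).
Proof.
apply: (iffP andP) => -[FE fF]; split=> //.
  by move=> x xE xF; move/forall_inP: fF; apply; rewrite inE xF.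
by apply/forall_inP => x; rewrite inE => /andP[xF xE]; apply: fF.
Qed.

Lemma flat_in_sub E F : flat_in E F -> F \subset E.
Proof. by case/andP. Qed.

Lemma flat_inT F : flat_in setT F = is_flat r F.
Proof.
apply/flat_inP/forallP => [[_ fF] x|fF]; first by apply/implyP => /fF; apply.
by split=> [|x _ xF]; [rewrite subsetT | apply: (implyP (fF x))].
Qed.

Lemma flat_in_refl E : flat_in E E.
Proof. by apply/flat_inP; split=> // x ->. Qed.

Lemma flat_in_lt E F A : flat_in E F -> F \proper A -> A \subset E -> (r F < r A)%N.
Proof.
case/flat_inP=> FE fF /properP[FA [x xA xF]] AE.
apply: leq_trans (fF x (subsetP AE x xA) xF) _.
by rewrite rank_mono // subUset sub1set xA.
Qed.

(** By [rank_setU_eq], an element outside [G] that fails to raise the rank of [F] also fails to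
    raise that of [G]. *)
Lemma flat_in_trans E G F : flat_in E G -> F \subset G -> flat_in G F = flat_in E F.
Proof.
move=> fG FG; case/flat_inP: (fG) => GE gG.
apply/flat_inP/flat_inP => -[_ fF]; split=> //; last 1 first.
- by move=> x xG; apply: fF; apply: (subsetP GE).
- exact: subset_trans GE.
move=> x xE xF; case: (boolP (x \in G)) => [xG|xG]; first exact: fF.
rewrite ltnNge; apply/negP => le.
have e : r F = r (x |: F) by apply/eqP; rewrite eqn_leq le rank_mono ?subsetUr.
have := gG x xE xG; have := rank_setU_eq G (subsetUr [set x] F) e.
by rewrite (setUidPr FG) -setUA (setUidPr FG) => <-; rewrite ltnn.
Qed.

Definition mcl A := [set x | r (x |: A) == r A].

Lemma sub_mcl A : A \subset mcl A.
Proof. by apply/subsetP => x xA; rewrite inE (setUidPr _) ?sub1set. Qed.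

Lemma rank_mclU A B : B \subset mcl A -> r (A :|: B) = r A.
Proof.
rewrite -(set_enum B); elim: (enum B) => [|x s IH].
  by rewrite (_ : [set y in [::]] = set0) ?setU0 //; apply/setP => y; rewrite !inE.
rewrite set_cons subUset sub1set => /andP[+ /IH e]; rewrite inE => /eqP rx.
by rewrite setUCA setUA -(rank_setU_eq _ (subsetUr [set x] A)).
Qed.

Lemma rank_mcl A : r (mcl A) = r A.
Proof. by rewrite -{1}(setUidPr (sub_mcl A)) rank_mclU. Qed.

Lemma mcl_flat A : is_flat r (mcl A).
Proof.
apply/forallP => x; apply/implyP; rewrite inE rank_mcl => ne.
apply: (@leq_trans (r (x |: A))).
  by rewrite ltn_neqAle eq_sym ne rank_mono ?subsetUr.
by rewrite rank_mono // setUS // sub_mcl.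
Qed.

Lemma mcl_min A F : is_flat r F -> A \subset F -> mcl A \subset F.
Proof.
move=> fF AF; apply/subsetP => x; rewrite inE => /eqP e.
apply/negPn/negP => xF; have := implyP (forallP fF x) xF.
have := rank_setU_eq F (subsetUr [set x] A) (esym e).
by rewrite -setUA (setUidPr AF) => ->; rewrite ltnn.
Qed.
End Matroid.

(** * The relations of the Chow ring *)

(** [Prop]-valued, because the ideals in view are annihilators of functionals, where membership
    quantifies over the whole ring. *)
Definition ideal_pred (A : comNzRingType) (Z : A -> Prop) :=
  [/\ Z 0, forall u v, Z u -> Z v -> Z (u + v) & forall a u, Z u -> Z (a * u)].

Section IdealTheory.
Variables (A : comNzRingType) (Z : A -> Prop).
Hypothesis Zid : ideal_pred Z.

Lemma ideal_zero : Z 0. Proof. by case: Zid. Qed.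
Lemma ideal_add u v : Z u -> Z v -> Z (u + v). Proof. by case: Zid => _ + _; apply. Qed.
Lemma ideal_mull a u : Z u -> Z (a * u). Proof. by case: Zid => _ _; apply. Qed.
Lemma ideal_mulr a u : Z u -> Z (u * a). Proof. by rewrite mulrC; apply: ideal_mull. Qed.
Lemma ideal_opp u : Z u -> Z (- u). Proof. by rewrite -mulN1r; apply: ideal_mull. Qed.
Lemma ideal_sub u v : Z u -> Z v -> Z (u - v).
Proof. by move=> Zu Zv; apply/ideal_add/ideal_opp. Qed.
Lemma ideal_sum (I : finType) (P : pred I) (F : I -> A) :
  (forall i, P i -> Z (F i)) -> Z (\sum_(i | P i) F i).
Proof. by move=> ZF; apply: big_ind => //; [exact: ideal_zero | exact: ideal_add]. Qed.

Lemma ideal_congr u v : Z (u - v) -> Z v -> Z u.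
Proof. by move=> d Zv; rewrite -(subrK v u); apply: ideal_add. Qed.

Lemma ideal_congrX a u v k : Z (a * (u - v)) -> Z (a * v ^+ k) -> Z (a * u ^+ k).
Proof.
move=> d; apply: ideal_congr; rewrite -mulrBr subrXX mulrA.
exact: ideal_mulr.
Qed.

Lemma ideal_exp_le a u k l : (k <= l)%N -> Z (a * u ^+ k) -> Z (a * u ^+ l).
Proof. by move=> /subnK <- Zk; rewrite exprD mulrCA; apply: ideal_mull. Qed.
End IdealTheory.

Section ChowRelations.
Variables (n : nat) (r : {set 'I_n} -> nat).
Hypothesis rM : is_matroid r.
Implicit Types C F G H K : {set 'I_n}.
Implicit Types P : {set {set 'I_n}}.

(** [P] holds the flats whose variables have been introduced so far. The full family [flats_above C]
    belongs to the Chow ring of [M / C]; smaller filters are the stages of its construction. *)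
Definition flat_filter C P :=
  (forall G, G \in P -> is_flat r G /\ C \proper G) /\
  (forall G H, G \in P -> is_flat r H -> G \subset H -> H \in P).

Definition flats_above C : {set {set 'I_n}} := [set F | is_flat r F & C \proper F].

Lemma flats_above_filter C : flat_filter C (flats_above C).
Proof.
split=> [G|G H]; rewrite !inE; first by move/andP.
by move=> /andP[_ CG] -> /(proper_sub_trans CG).
Qed.

Definition hsum (A : nmodType) (y : {set 'I_n} -> A) H := \sum_(K : {set 'I_n} | H \subset K) y K.

(* Writing the relation [h_H ^ rk(H / C)] of the contraction [M / C] as
   [x_C h_H ^ rk(H / C)] with [x_C = 1] puts it in the same form as the others. *)
Definition with_unit (A : pzSemiRingType) C (y : {set 'I_n} -> A) G :=
  if G == C then 1 else y G.

(** The Gröbner basis relations of Feichtner and Yuzvinsky, in the presentation with a variable for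
    the ground set. Variables are indexed by all subsets and killed outside [P], so that one ambient
    ring serves every [C] and [P]. *)
Definition chow_rels (A : comNzRingType) (Z : A -> Prop) (y : {set 'I_n} -> A) C P :=
  [/\ forall G, G \notin P -> Z (y G),
      forall G H, G \in P -> H \in P -> ~~ (G \subset H) -> ~~ (H \subset G) ->
        Z (y G * y H)
    & forall G H, (G == C) || (G \in P) -> H \in P -> G \proper H ->
        Z (with_unit C y G * hsum y H ^+ (r H - r G))].

Section Ideal.
Variables (A : comNzRingType) (Z : A -> Prop) (y : {set 'I_n} -> A).
Hypothesis Zid : ideal_pred Z.
Variables (C : {set 'I_n}) (P : {set {set 'I_n}}).
Hypothesis CP : flat_filter C P.
Hypothesis kill : forall G, G \notin P -> Z (y G).
Hypothesis incomp : forall G H, G \in P -> H \in P ->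
  ~~ (G \subset H) -> ~~ (H \subset G) -> Z (y G * y H).

Lemma flat_filter_unit : C \notin P.
Proof. by apply/negP => /(proj1 CP)[_]; rewrite properxx. Qed.

Lemma with_unit_neq G : G \in P -> with_unit C y G = y G.
Proof. by rewrite /with_unit; case: eqP => // -> /(negP flat_filter_unit). Qed.

(** Multiplied by [y G], the sums at [H] and at the join of [G] and [H] agree: a flat above [H] but
    not above the join is incomparable with [G], so the product of the two variables vanishes. For
    [G = C] there is no such flat in [P]. *)
Lemma with_unit_mul_hsum G H : (G == C) || (G \in P) -> ~~ (H \subset G) ->
  Z (with_unit C y G * (hsum y H - hsum y (mcl r (G :|: H)))).
Proof.
move=> GCP HG; rewrite /hsum (bigID (fun K : {set 'I_n} => mcl r (G :|: H) \subset K)) /=.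
rewrite (eq_bigl (fun K : {set 'I_n} => mcl r (G :|: H) \subset K)) => [|K]; last first.
  rewrite andb_idl // => /(subset_trans (sub_mcl _ _)).
  by rewrite subUset => /andP[].
rewrite addrC addrK mulr_sumr; apply: ideal_sum => // K /andP[HK nK].
have [KP|/kill] := boolP (K \in P); last exact: ideal_mull.
have KG : ~~ (K \subset G) by apply: contra HG; apply: subset_trans.
have GK : ~~ (G \subset K).
  apply: contra nK => GK; apply: mcl_min => //; first by case/(proj1 CP): KP.
  by rewrite subUset GK.
have GP : G \in P.
  case/orP: GCP => // /eqP eG; case/negP: GK; rewrite eG.
  by case/(proj1 CP): KP => _ /proper_sub.
by rewrite with_unit_neq //; apply: incomp.
Qed.

Lemma mcl_filter G H : G \in P -> mcl r (G :|: H) \in P.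
Proof.
move=> GP; apply: (proj2 CP _ _ GP) (mcl_flat rM _) _.
by rewrite (subset_trans _ (sub_mcl r _)) ?subsetUl.
Qed.

Lemma proper_mclU G H : ~~ (H \subset G) -> G \proper mcl r (G :|: H).
Proof.
move=> HG; apply: (proper_sub_trans _ (sub_mcl r _)).
by rewrite properEneq subsetUl andbT; apply: contraNneq HG => ->; apply: subsetUr.
Qed.

Lemma rank_mclU_le G H K : K \subset G -> K \subset H ->
  (r (mcl r (G :|: H)) - r G <= r H - r K)%N.
Proof.
move=> KG KH; rewrite rank_mcl //.
have: (r K <= r (G :&: H))%N by rewrite rank_mono // subsetI KG.
have := rank_submod rM G H; lia.
Qed.
End Ideal.

Section Relations.
Variables (A : comNzRingType) (Z : A -> Prop) (y : {set 'I_n} -> A).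
Hypothesis Zid : ideal_pred Z.
Variables (C : {set 'I_n}) (P : {set {set 'I_n}}).
Hypothesis CP : flat_filter C P.

(** The factor [y G] turns the sum at [H] into the sum at the join, for which the power relation
    holds. *)
Lemma rels_mul_hsumX G H k : chow_rels Z y C P -> G \in P -> ~~ (H \subset G) ->
  (r (mcl r (G :|: H)) - r G <= k)%N -> Z (y G * hsum y H ^+ k).
Proof.
case=> [kill incomp pow] GP HG le.
rewrite -(with_unit_neq y CP GP); apply: ideal_congrX => //.
  by apply: (with_unit_mul_hsum Zid CP) => //; rewrite GP orbT.
apply: (ideal_exp_le Zid le); apply: pow; rewrite ?GP ?orbT //.
- exact: (mcl_filter CP).
- exact: (proper_mclU HG).
Qed.

(* Multiplication by the class [h_F ^ rk(F / C)] of the centre maps functionals of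
   [M / C] to functionals of [M / F]. *)
Lemma rels_contract F : is_flat r F -> C \proper F -> F \notin P ->
  flats_above F \subset P -> chow_rels Z y C P ->
  chow_rels (fun z => Z (z * (hsum y F) ^+ (r F - r C))) y F (flats_above F).
Proof.
move=> fF CF FP upP rels; have [kill incomp pow] := rels.
split=> [G|G H|G H].
- move=> GF; have [GP|/kill] := boolP (G \in P); last exact: ideal_mulr.
  have [fG CG] := proj1 CP G GP.
  have FG : ~~ (F \subset G).
    apply: contra GF => FG; rewrite inE fG properEneq FG andbT.
    by apply: contraNneq FP => ->.
  by apply: rels_mul_hsumX => //; apply: rank_mclU_le; apply: proper_sub.
- move=> /(subsetP upP) GP /(subsetP upP) HP GH HG.
  by apply: ideal_mulr => //; apply: incomp.
move=> /orP[/eqP->|GF] HF GH.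
  rewrite /with_unit eqxx mul1r.
  have [fH _] : is_flat r H /\ F \proper H by move: HF; rewrite inE => /andP[].
  have HP := subsetP upP _ HF.
  apply: (ideal_congrX _ (v := hsum y H)) => //.
    set a := hsum y H ^+ _.
    rewrite /hsum (bigID (fun K : {set 'I_n} => H \subset K)) /=.
    rewrite (eq_bigl (fun K : {set 'I_n} => H \subset K)) => [|K]; last first.
      by rewrite andb_idl //; apply: subset_trans; apply: proper_sub.
    rewrite [X in X - _]addrC addrK mulr_sumr; apply: ideal_sum => // K /andP[FK HK].
    rewrite mulrC /a; have [KP|/kill] := boolP (K \in P); last exact: ideal_mulr.
    by apply: rels_mul_hsumX => //; apply: rank_mclU_le => //; apply: proper_sub.
  have CH : C \proper H by apply: proper_trans GH.
  have := pow C H; rewrite eqxx /with_unit eqxx mul1r => /(_ isT HP CH).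
  rewrite -exprD; congr (Z (_ ^+ _)).
  have := rank_mono rM (proper_sub GH); have := rank_mono rM (proper_sub CF).
  lia.
apply: ideal_mulr => //; have GP := subsetP upP _ GF.
have := pow G H; rewrite GP orbT => /(_ isT (subsetP upP _ HF) GH).
by rewrite (with_unit_neq _ CP) // (with_unit_neq _ (flats_above_filter F)).
Qed.

(** The ring of [M / F] is a quotient of the ring of [C] and [P]: killing the flats not above [F]
    turns the sum at [H] into the sum at the join of [F] and [H], and by submodularity the exponent
    required in [M / F] is no larger. *)
Lemma rels_expand F : is_flat r F -> C \proper F -> F \notin P ->
  flats_above F \subset P -> chow_rels Z y F (flats_above F) -> chow_rels Z y C P.
Proof.
move=> fF CF FP upP rels; have [kill incomp pow] := rels.
have upF := flats_above_filter F.
have hH k H : (r (mcl r (F :|: H)) - r F <= k)%N -> ~~ (H \subset F) ->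
    Z (hsum y H ^+ k).
  move=> le HF; rewrite -[_ ^+ _]mul1r; apply: ideal_congrX => //.
    have := with_unit_mul_hsum Zid upF kill incomp (G := F) (H := H).
    by rewrite eqxx /with_unit eqxx; apply.
  apply: (ideal_exp_le Zid le).
  have := pow F (mcl r (F :|: H)).
  rewrite eqxx !inE mcl_flat //= /with_unit eqxx proper_mclU //.
  exact.
split=> [G GP|G H GP HP GH HG|G H].
- by apply: kill; apply: contra GP; apply: (subsetP upP).
- have [GF|/kill] := boolP (G \in flats_above F); last exact: ideal_mulr.
  have [HF|/kill] := boolP (H \in flats_above F); last exact: ideal_mull.
  exact: incomp.
case/orP=> [/eqP-> HP CH|GP HP GH].
  rewrite /with_unit eqxx mul1r; apply: hH.
    by apply: rank_mclU_le => //; apply: proper_sub.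
  by apply: contra FP; apply: (proj2 CP).
rewrite (with_unit_neq _ CP) //.
have [GF|/kill] := boolP (G \in flats_above F); last exact: ideal_mulr.
rewrite -(with_unit_neq y upF) //; apply: pow; rewrite ?GF ?orbT // inE.
have [-> _] := proj1 CP _ HP.
by move: GF; rewrite inE => /andP[_] /proper_trans ->.
Qed.
End Relations.

(** The linear and quadratic relations imply all power relations, by induction on the exponent. An
    element [i] of [H] outside [G] gives a flat [J] between them with [a * hsum y J] in the ideal,
    which trades one factor [hsum y H] for variables of flats above [J]. *)
Lemma linear_rels (A : comNzRingType) (Z : A -> Prop) (y : {set 'I_n} -> A) :
  ideal_pred Z -> is_flat r set0 ->
  (forall G, G \notin flats_above set0 -> Z (y G)) ->
  (forall G H, G \in flats_above set0 -> H \in flats_above set0 ->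
    ~~ (G \subset H) -> ~~ (H \subset G) -> Z (y G * y H)) ->
  (forall i, Z (hsum y [set i])) ->
  chow_rels Z y set0 (flats_above set0).
Proof.
move=> Zid f0 kill incomp lin; split=> //.
have CP := flats_above_filter set0; set P := flats_above set0 in kill incomp CP *.
have flatP G : (G == set0) || (G \in P) -> is_flat r G.
  by case/orP => [/eqP->|/(proj1 CP)[]].
(* The exponent is allowed to exceed the relative rank, so that the induction can run on it. *)
suff pow k G H : (G == set0) || (G \in P) -> H \in P -> G \proper H ->
    (r H - r G <= k)%N -> Z (with_unit set0 y G * hsum y H ^+ k).
  by move=> G H GP HP GH; apply: pow.
elim: k G H => [|k IH] G H GP HP GH le.
  have: (r G < r H)%N.
    by apply: (@flat_in_lt n r rM setT); rewrite ?flat_inT ?flatP ?subsetT.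
  by rewrite -subn_gt0; case: (r H - r G)%N le.
have fH : is_flat r H by apply: flatP; rewrite HP orbT.
case/properP: (GH) => GsH [i iH iG].
have siG : ~~ ([set i] \subset G) by rewrite sub1set.
pose J := mcl r (G :|: [set i]).
have JH : J \subset H by apply: mcl_min; rewrite ?fH // subUset GsH sub1set.
have rJ : (r G < r J)%N.
  apply: (@flat_in_lt n r rM setT); rewrite ?flat_inT ?flatP ?subsetT //.
  exact: proper_mclU.
set a := with_unit _ _ _.
have aJ : Z (a * hsum y J).
  rewrite -[hsum y J](subKr (hsum y [set i])) mulrBr; apply: ideal_sub => //.
    exact: ideal_mull.
  exact: (with_unit_mul_hsum Zid CP kill incomp).
(* One factor is written as [hsum y J - (hsum y J - hsum y H)]. The first part is killed; the second
   is the sum of the variables of the [K] above [J] but not above [H]. *)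
rewrite exprS -[X in a * (X * _)](subKr (hsum y J)) mulrBl mulrBr mulrA.
apply: ideal_sub => //; first exact: ideal_mulr.
rewrite /hsum (bigID (fun K : {set 'I_n} => H \subset K)) /= -/(hsum y H).
rewrite (eq_bigl (fun K : {set 'I_n} => H \subset K)) => [|K]; last first.
  by rewrite andb_idl //; apply: subset_trans.
rewrite -/(hsum y H) [X in X - _]addrC addrK; apply: ideal_mull => //; rewrite mulr_suml.
apply: ideal_sum => // K /andP[JK HK].
have [KP|/kill] := boolP (K \in P); last exact: ideal_mulr.
have KP' : (K == set0) || (K \in P) by rewrite KP orbT.
rewrite -(with_unit_neq y CP KP); apply: ideal_congrX => //.
  exact: (with_unit_mul_hsum Zid CP kill incomp).
apply: IH => //; first exact: (mcl_filter CP).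
  exact: proper_mclU.
(* The join of [K] and [H] has rank over [K] at most [r H - r J], which is less than [r H - r G]. *)
apply: leq_trans (rank_mclU_le JK JH) _.
by move: le rJ; move: (r H) (r J) (r G) => rh rj rg; clear; lia.
Qed.
End ChowRelations.

(** * Functionals modulo a monic polynomial *)

Definition lin (V : lmodType rat) (L : V -> rat) :=
  forall a u v, L (a *: u + v) = a * L u + L v.

Section Lin.
Variables (V : lmodType rat) (L : V -> rat).
Hypothesis linL : lin L.

Lemma lin0 : L 0 = 0.
Proof. by have := linL (-1) 0 0; rewrite scaler0 addr0 mulN1r addNr. Qed.
Lemma linD u v : L (u + v) = L u + L v.
Proof. by rewrite -[u]scale1r linL mul1r scale1r. Qed.
Lemma linZ a u : L (a *: u) = a * L u.
Proof. by rewrite -[a *: u]addr0 linL lin0 addr0. Qed.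
Lemma lin_sum I (s : seq I) P (F : I -> V) :
  L (\sum_(i <- s | P i) F i) = \sum_(i <- s | P i) L (F i).
Proof. by apply: (big_morph L linD lin0). Qed.
End Lin.

(** For linear [L], the largest ideal contained in its kernel. *)
Definition annihilator (A : comAlgType rat) (L : A -> rat) (z : A) :=
  forall p, L (p * z) = 0.

Lemma annihilator_ideal (A : comAlgType rat) (L : A -> rat) :
  lin L -> ideal_pred (annihilator L).
Proof.
move=> linL; split=> [p|u v Lu Lv p|a u Lu p].
- by rewrite mulr0 lin0.
- by rewrite mulrDr linD // Lu Lv addr0.
- by rewrite mulrA Lu.
Qed.

Section RemainderFunctional.
Variables (A : comAlgType rat) (h : A) (c : nat) (phi : 'I_c.+1 -> A -> rat).
Hypothesis lin_phi : forall j, lin (phi j).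

Let Q : {poly A} := ('X + h%:P) ^+ c.+1.
(** A functional on [A[X]] modulo the monic [Q]: the quotient is free over [A] on the first [c.+1]
    powers of [X], so one functional of [A] may be chosen for each coefficient of the remainder. *)
Definition rem_functional (p : {poly A}) := \sum_(j < c.+1) phi j (Pdiv.Ring.rmodp p Q)`_j.

Let monQ : Q \is monic.
Proof. by rewrite monic_exp // -[h]opprK polyCN monicXsubC. Qed.

Let sizeQ : size Q = c.+2.
Proof. by rewrite /Q -[h]opprK polyCN size_exp_XsubC. Qed.

Let Q0 : Q`_0 = h ^+ c.+1.
Proof. by rewrite -horner_coef0 /Q !hornerE. Qed.

Lemma rem_functional_lin a u v :
  rem_functional (a%:A%:P * u + v) = a * rem_functional u + rem_functional v.
Proof.
rewrite /rem_functional mul_polyC Pdiv.RingMonic.rmodpD // Pdiv.RingMonic.rmodpZ //.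
rewrite mulr_sumr -big_split /=; apply: eq_bigr => j _.
by rewrite coefD coefZ -scalerAl mul1r lin_phi.
Qed.

Lemma rem_functional_monomial b (j : 'I_c.+1) : rem_functional (b%:P * 'X^j) = phi j b.
Proof.
rewrite /rem_functional Pdiv.Ring.rmodp_small; last first.
  rewrite sizeQ mul_polyC; apply: (leq_ltn_trans (size_scale_leq _ _)).
  by rewrite size_polyXn !ltnS -ltnS.
rewrite (bigD1 j) //= big1 => [|i ij].
  by rewrite coefCM coefXn eqxx mulr1 addr0.
by rewrite coefCM coefXn (inj_eq val_inj) (negPf ij) mulr0 (lin0 (lin_phi _)).
Qed.

Lemma rem_functional_const k : (forall j, annihilator (phi j) k) ->
  forall p, rem_functional (p * k%:P) = 0.
Proof.
move=> phik p; rewrite /rem_functional big1 // => j _.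
by rewrite mulrC mul_polyC Pdiv.RingMonic.rmodpZ // coefZ mulrC phik.
Qed.

Lemma rem_functional_modulus p : rem_functional (p * Q) = 0.
Proof.
rewrite /rem_functional Pdiv.RingMonic.rmodp_mull // big1 // => j _.
by rewrite coef0 (lin0 (lin_phi _)).
Qed.

(** If [s] is the remainder of [p], that of [p * 'X] is [s * 'X] minus its leading coefficient times
    [Q]. Only the constant coefficient escapes the hypothesis on the [phi j] with [j != ord0], and
    it is a multiple of [h ^+ c.+1]. *)
Lemma rem_functional_X k : (forall j, j != ord0 -> annihilator (phi j) k) ->
  annihilator (phi ord0) (k * h ^+ c.+1) ->
  forall p, rem_functional (p * (k%:P * 'X)) = 0.
Proof.
move=> phik phi0 p; rewrite /rem_functional.
set s := Pdiv.Ring.rmodp p Q; pose t := s * 'X - s`_c *: Q.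
have size_s : (size s <= c.+1)%N.
  by rewrite -ltnS -sizeQ Pdiv.Ring.ltn_rmodpN0 // monic_neq0.
have Qc : Q`_c.+1 = 1 by move: (monicP monQ); rewrite lead_coefE sizeQ.
have size_t : (size t <= c.+1)%N.
  apply/leq_sizeP => j; rewrite leq_eqVlt => /predU1P[<-|cj].
    by rewrite coefB coefMX coefZ Qc mulr1 subrr.
  rewrite coefB coefMX coefZ [Q`_j]nth_default ?sizeQ // mulr0 subr0.
  case: j cj => // j cj; rewrite /= nth_default //.
  by apply: leq_trans size_s _.
have -> : Pdiv.Ring.rmodp (p * (k%:P * 'X)) Q = k *: t.
  rewrite mulrCA mul_polyC Pdiv.RingMonic.rmodpZ //; congr (_ *: _).
  rewrite [p](Pdiv.RingMonic.rdivp_eq monQ) -/s mulrDl mulrAC.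
  rewrite -[s * 'X](subrK (s`_c *: Q)) -/t -mul_polyC [t + _]addrC addrA -mulrDl.
  by rewrite Pdiv.RingMonic.rmodp_addl_mul_small // sizeQ ltnS.
rewrite big1 // => j _; have [->|j0] := eqVneq j ord0; last first.
  by rewrite coefZ mulrC phik.
rewrite coefZ coefB coefMX coefZ /= sub0r Q0.
by rewrite (_ : k * _ = - s`_c * (k * h ^+ c.+1)) ?phi0 //; ring.
Qed.
End RemainderFunctional.

(** * Functionals vanishing on the relations *)

Section Functionals.
Variables (n : nat) (r : {set 'I_n} -> nat).
Hypothesis rM : is_matroid r.
Implicit Types C F G H K : {set 'I_n}.
Implicit Types P : {set {set 'I_n}}.

Local Notation N := #|{: {set 'I_n}}|.
Local Notation S := {mpoly rat[N]}.
Local Notation mono := 'X_{1..N}.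
Definition svar F : S := 'X_(enum_rank F).

(** The dual of the ring cut out by [chow_rels], described without forming the quotient ring. *)
Definition chow_functional C P (L : S -> rat) :=
  lin L /\ chow_rels r (annihilator L) svar C P.

(* The exponent vectors of the Feichtner-Yuzvinsky monomials
   [x_F1 ^ j1 ... x_Fk ^ jk], with [C < F1 < ... < Fk], [F1 \in P] and
   [0 < ji < rk (Fi / F(i-1))]. *)
Inductive FY C P : mono -> Prop :=
| FY0 : FY C P 0%MM
| FYS F j m : F \in P -> (0 < j < r F - r C)%N -> FY F (flats_above r F) m ->
    FY C P (U_(enum_rank F) *+ j + m)%MM.

Lemma FY_support C P m G : flat_filter r C P -> FY C P m -> G \notin P ->
  m (enum_rank G) = 0%N.
Proof.
move=> CP mP; elim: {C P m} mP CP G => [C P|C P F j m FP _ _ IH] CP G GP.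
  by rewrite mnm0E.
rewrite mnmDE mulmnE mnm1E (inj_eq enum_rank_inj).
rewrite IH ?addn0; [|exact: flats_above_filter|].
  by case: eqP GP => // <- /negP.
apply: contra GP; rewrite inE => /andP[fG FG].
exact: (proj2 CP _ _ FP fG (proper_sub FG)).
Qed.

Lemma FY_mono C P P' m : P' \subset P -> FY C P' m -> FY C P m.
Proof.
move=> /subsetP PP; case=> [|F j m' /PP FP jF mF]; first exact: FY0.
exact: FYS.
Qed.

Lemma svar_msupp (m : mono) (T : comNzRingType) (e : {rmorphism S -> T})
    (e' : {rmorphism S -> T}) :
  (forall i, m i != 0%N -> e 'X_i = e' 'X_i) -> e 'X_[m] = e' 'X_[m].
Proof.
move=> ee'; rewrite mpolyXE_id !rmorph_prod; apply: eq_bigr => i _.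
rewrite !rmorphXn; have [->|/ee' -> //] := eqVneq (m i) 0%N.
by rewrite !expr0.
Qed.

Lemma lin_mpoly0 (L : S -> rat) : lin L -> (forall m, L 'X_[m] = 0) -> forall p, L p = 0.
Proof.
move=> linL L0; elim/mpolyind => [|a m p _ _ IH]; first exact: lin0.
by rewrite linL L0 IH mulr0 addr0.
Qed.

(** Deleting a flat of least cardinality keeps [P] upward closed, and all flats properly above it
    stay in [P]. This is the order in which variables are added. *)
Lemma filter_min_ind C (Q : {set {set 'I_n}} -> Prop) :
  Q set0 ->
  (forall P F, flat_filter r C P -> flat_filter r C (P :\ F) -> F \in P ->
     (forall G, G \in P -> G \subset F -> G = F) ->
     flats_above r F \subset P :\ F -> Q (P :\ F) -> Q P) ->
  forall P, flat_filter r C P -> Q P.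
Proof.
move=> Q0 QS P; elim: {P}_.+1 {-2}P (ltnSn #|P|) => // k IH P cP CP.
have [->//|[F0 F0P]] := set_0Vmem P.
have [F FP Fmin] := @arg_minnP _ F0 (mem P) (fun G => #|G|) F0P.
have {}FP : F \in P := FP.
have min G : G \in P -> G \subset F -> G = F.
  by move=> GP GF; apply/eqP; rewrite eqEcard GF Fmin.
have CPF : flat_filter r C (P :\ F).
  split=> [G|G H]; first by rewrite inE => /andP[_ /(proj1 CP)].
  rewrite !inE => /andP[GF GP] fH GH; rewrite (proj2 CP _ _ GP fH GH) andbT.
  by apply: contraNneq GF => HF; rewrite (min G GP) // -HF.
apply: (QS P F) => //.
  apply/subsetP => G; rewrite !inE => /andP[fG FG].
  rewrite (proj2 CP F G) ?proper_sub // andbT.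
  by apply: contraTneq FG => ->; rewrite properxx.
by apply: IH => //; rewrite (cardsD1 F) FP add1n in cP.
Qed.

(** * Adding and removing the variable of a minimal flat *)

Section Step.
Variables (C F : {set 'I_n}) (P : {set {set 'I_n}}).
Hypotheses (CP : flat_filter r C P) (CPF : flat_filter r C (P :\ F)) (FP : F \in P).
Hypothesis Fmin : forall G, G \in P -> G \subset F -> G = F.
Hypothesis upF : flats_above r F \subset P :\ F.

Let fF : is_flat r F. Proof. by case: (proj1 CP _ FP). Qed.
Let CF : C \proper F. Proof. by case: (proj1 CP _ FP). Qed.
Let FPF : F \notin P :\ F. Proof. by rewrite !inE eqxx. Qed.
Let CneqF : C != F. Proof. by apply: contraTneq CF => ->; rewrite properxx. Qed.

Let tailsum (A : nmodType) (y : {set 'I_n} -> A) := \sum_(K : {set 'I_n} | F \proper K) y K.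

Let hsumF (A : nmodType) (y : {set 'I_n} -> A) : hsum y F = y F + tailsum y.
Proof.
rewrite /hsum (bigD1 F) //=; congr (_ + _); apply: eq_bigl => K.
by rewrite properEneq eq_sym andbC.
Qed.

Let not_sub H : H \in P -> H != F -> ~~ (H \subset F).
Proof. by move=> HP; apply: contra => /(Fmin HP) ->. Qed.

Section Extend.
Variables (c : nat) (phi : 'I_c.+1 -> S -> rat).
Hypothesis rc : c.+1 = (r F - r C)%N.
Hypothesis phi0 : chow_functional C (P :\ F) (phi ord0).
Hypothesis phiS : forall j, j != ord0 -> chow_functional F (flats_above r F) (phi j).

Let h : S := tailsum svar.

Let evvar (i : 'I_N) : {poly S} := if enum_val i == F then 'X else ('X_i)%:P.
(** Reads a polynomial as one in the variable of [F], with coefficients in the other variables. *)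
Definition split_var : S -> {poly S} := mmap (polyC \o @mpolyC N rat) evvar.
HB.instance Definition _ := GRing.RMorphism.on split_var.

Let ev_var G : split_var (svar G) = if G == F then 'X else (svar G)%:P.
Proof. by rewrite /split_var mmapX mmap1U /evvar enum_rankK. Qed.

Let ev_hsum H : ~~ (H \subset F) -> split_var (hsum svar H) = (hsum svar H)%:P.
Proof.
move=> HF; rewrite /hsum !rmorph_sum; apply: eq_bigr => K HK.
by rewrite /= ev_var; case: eqP HK => // ->; rewrite (negPf HF).
Qed.

Let ev_hsumF : split_var (hsum svar F) = 'X + h%:P.
Proof.
rewrite hsumF rmorphD /= ev_var eqxx; congr (_ + _); rewrite !rmorph_sum.
apply: eq_bigr => K FK; rewrite /= ev_var; case: eqP FK => // ->.
by rewrite properxx.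
Qed.

Let linphi j : lin (phi j).
Proof. by have [->|/phiS[]] := eqVneq j ord0; first by case: phi0. Qed.

Let L (p : S) := rem_functional h phi (split_var p).

Let linL : lin L.
Proof.
move=> a u v; rewrite /L -mul_mpolyC rmorphD rmorphM /=.
rewrite -(rem_functional_lin h linphi); congr (rem_functional _ _ (_ * _ + _)).
by rewrite /split_var mmapC /= alg_mpolyC.
Qed.

(** The functionals of [M / F] also respect the relations of the smaller filter, by
    [rels_expand]. *)
Let rels j : chow_rels r (annihilator (phi j)) svar C (P :\ F).
Proof.
have [->|j0] := eqVneq j ord0; first by case: phi0.
apply: (rels_expand rM (annihilator_ideal (linphi j)) CPF fF CF FPF upF).
by case: (phiS j0).
Qed.

(** The sum [h] omits the variable of [F], which is killed here, so it may be replaced by the full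
    sum at [F]. *)
Let relsX k : (forall j, j != ord0 -> annihilator (phi j) k) ->
  annihilator (phi ord0) (k * hsum svar F ^+ (r F - r C)) ->
  forall p, rem_functional h phi (p * (k%:P * 'X)) = 0.
Proof.
move=> kS k0; apply: rem_functional_X => //.
apply: (ideal_congrX (annihilator_ideal (linphi ord0))); last by rewrite -rc in k0; exact: k0.
rewrite hsumF opprD addrCA subrr addr0.
have Zid := annihilator_ideal (linphi ord0).
apply: (ideal_mull Zid); apply: (ideal_opp Zid).
by have [kill _ _] := rels ord0; apply: kill.
Qed.

Let relsF := rels_contract rM (annihilator_ideal (linphi ord0)) CPF fF CF FPF upF (rels ord0).

Let LE z w : split_var z = w -> (forall p, rem_functional h phi (p * w) = 0) ->
  annihilator L z.
Proof. by move=> zw Lw p; rewrite /L rmorphM /= zw. Qed.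

(** Relations free of the variable of [F] become constants killed by every [phi j]. Those with that
    variable as a factor fall under [relsX]. The power relation at [F] itself is the modulus. *)
Lemma extend_chow_functional : chow_functional C P L.
Proof.
split=> //; split=> [G GP|G H GP HP GH HG|G H GP HP GH].
- have GF : G != F by apply: contraNneq GP => ->.
  apply: (LE (w := (svar G)%:P)); first by rewrite ev_var (negPf GF).
  apply: rem_functional_const => // j; have [kill _ _] := rels j.
  by apply: kill; rewrite inE (negPf GP) andbF.
- wlog GF : G H GP HP GH HG / G != F.
    move=> W; have [GF|] := eqVneq G F; last exact: W.
    rewrite mulrC; apply: W => //; apply: contraNneq GH => ->; by rewrite GF.
  have [HF|HF] := eqVneq H F.
    apply: (LE (w := (svar G)%:P * 'X)); first by rewrite rmorphM /= !ev_var (negPf GF) HF eqxx.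
    have GnF : G \notin flats_above r F.
      by rewrite inE properE -HF (negPf HG) /= andbF.
    apply: relsX => [j j0|].
      by have [_ [kill _ _]] := phiS j0; apply: kill.
    by have [kill _ _] := relsF; apply: kill.
  apply: (LE (w := (svar G * svar H)%:P)).
    by rewrite rmorphM /= !ev_var (negPf GF) (negPf HF) -polyCM.
  apply: rem_functional_const => // j; have [_ incomp _] := rels j.
  by apply: incomp; rewrite ?inE ?GF ?HF.
(* As [F] is minimal in [P], only [C] can lie properly below it, and the relation is the modulus
   [('X + h%:P) ^+ c.+1]. *)
have [HF|HF] := eqVneq H F.
  have -> : G = C.
    case/orP: GP => [/eqP //|GP]; move: GH; rewrite HF => GF.
    by move: (GF); rewrite (Fmin GP (proper_sub GF)) properxx.
  apply: (LE (w := ('X + h%:P) ^+ c.+1)).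
    by rewrite /with_unit eqxx mul1r rmorphXn HF /= ev_hsumF rc.
  exact: rem_functional_modulus.
have HnF := not_sub HP HF.
(* The cofactor of the variable of [F] is the power relation of [M / F] at its centre. It is killed
   by the higher [phi j], and by [phi ord0] after multiplication with the class of the centre
   ([relsF]). *)
have [GF|GF] := eqVneq G F.
  apply: (LE (w := (hsum svar H ^+ (r H - r F))%:P * 'X)).
    rewrite GF /with_unit eq_sym (negPf CneqF) mulrC rmorphM rmorphXn /= ev_hsum //.
    by rewrite ev_var eqxx polyC_exp.
  have HupF : H \in flats_above r F.
    by rewrite inE -GF GH andbT; case: (proj1 CP _ HP).
  apply: relsX => [j j0|].
    have [_ [_ _ pow]] := phiS j0; have := pow F H; rewrite eqxx /with_unit eqxx mul1r.
    by apply=> //; rewrite -GF.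
  have [_ _ pow] := relsF; have := pow F H; rewrite eqxx /with_unit eqxx mul1r.
  by apply=> //; rewrite -GF.
apply: (LE (w := (with_unit C svar G * hsum svar H ^+ (r H - r G))%:P)).
  rewrite rmorphM rmorphXn /= ev_hsum // polyCM polyC_exp; congr (_ * _).
  by rewrite /with_unit; case: eqP => _; rewrite ?rmorph1 // ev_var (negPf GF).
apply: rem_functional_const => // j; have [_ _ pow] := rels j.
by apply: pow; rewrite ?inE ?GF ?HF.
Qed.

Let ev_mono (m : mono) : m (enum_rank F) = 0%N -> split_var 'X_[m] = ('X_[m])%:P.
Proof.
move=> mF; rewrite (@svar_msupp m _ split_var polyC) // => i mi.
have -> : 'X_i = svar (enum_val i) by rewrite /svar enum_valK.
rewrite /= ev_var; case: eqP => // e.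
by move: mi; rewrite -(enum_valK i) e mF.
Qed.

Lemma extend_value (j : 'I_c.+1) (m : mono) : m (enum_rank F) = 0%N ->
  L 'X_[(U_(enum_rank F) *+ j + m)%MM] = phi j 'X_[m].
Proof.
move=> mF; rewrite /L mpolyXD -mpolyXn mulrC rmorphM rmorphXn /= ev_mono //.
by rewrite -/(svar F) ev_var eqxx rem_functional_monomial.
Qed.
End Extend.

Section Restrict.
Variable L : S -> rat.
Hypothesis funL : chow_functional C P L.

Let linL : lin L. Proof. by case: funL. Qed.
Let killL G : G \notin P -> annihilator L (svar G).
Proof. by case: funL => _ [+ _ _]; apply. Qed.
Let incompL G H : G \in P -> H \in P -> ~~ (G \subset H) -> ~~ (H \subset G) ->
  annihilator L (svar G * svar H).
Proof. by case: funL => _ [_ + _]; apply. Qed.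
Let powL G H : (G == C) || (G \in P) -> H \in P -> G \proper H ->
  annihilator L (with_unit C svar G * hsum svar H ^+ (r H - r G)).
Proof. by case: funL => _ [_ _ +]; apply. Qed.

Definition drop_var : S -> S :=
  mmap (@mpolyC N rat) (fun i : 'I_N => if enum_val i == F then 0 else 'X_i : S).
HB.instance Definition _ := GRing.RMorphism.on drop_var.

Let dv_var G : drop_var (svar G) = if G == F then 0 else svar G.
Proof. by rewrite /drop_var mmapX mmap1U enum_rankK. Qed.

Let dv_hsum H : ~~ (H \subset F) -> drop_var (hsum svar H) = hsum svar H.
Proof.
move=> HF; rewrite /hsum !rmorph_sum; apply: eq_bigr => K HK.
by rewrite /= dv_var; case: eqP HK => // ->; rewrite (negPf HF).
Qed.

Let dv_tail : drop_var (tailsum svar) = tailsum svar.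
Proof.
rewrite /tailsum !rmorph_sum; apply: eq_bigr => K FK.
by rewrite /= dv_var; case: eqP FK => // ->; rewrite properxx.
Qed.

Let dv_unit G : G != F -> drop_var (with_unit C svar G) = with_unit C svar G.
Proof. by move=> GF; rewrite /with_unit; case: eqP => _; rewrite ?rmorph1 // dv_var (negPf GF). Qed.

(** The functional dual to the coefficient of the [j]-th power of the variable of [F]; [drop_var]
    makes it defined on all of [S]. *)
Definition slice (j : nat) (p : S) := L (drop_var p * svar F ^+ j).

Let lin_slice j : lin (slice j).
Proof.
move=> a u v; rewrite /slice -mul_mpolyC rmorphD rmorphM /=.
by rewrite {1}/drop_var mmapC mulrDl -mulrA mul_mpolyC linL.
Qed.

Let slice_ann j z : annihilator L (drop_var z * svar F ^+ j) -> annihilator (slice j) z.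
Proof. by move=> Lz p; rewrite /slice rmorphM /= -mulrA; apply: Lz. Qed.

Let slice_kill z : drop_var z = 0 -> forall j, annihilator (slice j) z.
Proof. by move=> z0 j p; rewrite /slice rmorphM /= z0 mulr0 mul0r (lin0 linL). Qed.

(** No other flat of [P] lies below [F], so the sums at these flats do not contain the variable of
    [F] and survive [drop_var]. *)
Lemma slice0_functional : chow_functional C (P :\ F) (slice 0).
Proof.
have Zid := annihilator_ideal linL.
split; [exact: lin_slice | split=> [G|G H|G H]].
- rewrite !inE negb_and negbK; have [->|GF /= GP] := eqVneq G F.
    by move=> _; apply: slice_kill; rewrite dv_var eqxx.
  by apply: slice_ann; rewrite expr0 mulr1 dv_var (negPf GF); apply: killL.
- rewrite !inE => /andP[GF GP] /andP[HF HP] GH HG.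
  apply: slice_ann; rewrite expr0 mulr1 rmorphM /= !dv_var (negPf GF) (negPf HF).
  exact: incompL.
rewrite !inE => GP /andP[HF HP] GH; apply: slice_ann.
have GF : G != F by case/orP: GP => [/eqP ->|/andP[]].
rewrite expr0 mulr1 rmorphM rmorphXn /= dv_hsum ?not_sub // dv_unit //.
by apply: powL => //; case/orP: GP => [->|/andP[_ ->]] //; rewrite orbT.
Qed.

(** The factor [svar F] kills the flats of [P] incomparable with [F], and supplies the variable that
    the relations of [M / F] replace by 1. *)
Lemma sliceS_functional j : chow_functional F (flats_above r F) (slice j.+1).
Proof.
have Zid := annihilator_ideal linL.
have upP K : K \in flats_above r F -> [/\ K != F, K \in P & F \proper K].
  move=> KF; have := subsetP upF K KF; rewrite !inE => /andP[-> ->].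
  by move: KF; rewrite inE => /andP[].
have ann1 z : annihilator L (drop_var z * svar F) -> annihilator (slice j.+1) z.
  by move=> Lz; apply: slice_ann; rewrite exprS mulrA; apply: (ideal_mulr Zid).
split; [exact: lin_slice | split=> [G|G H|G H]].
- move=> GF; have [->|GnF] := eqVneq G F; first by apply: slice_kill; rewrite dv_var eqxx.
  apply: ann1; rewrite dv_var (negPf GnF).
  have [GP|/killL] := boolP (G \in P); last exact: (ideal_mulr Zid).
  apply: incompL => //; first exact: not_sub.
  apply: contra GF => FG; rewrite inE properEneq eq_sym GnF FG.
  by case: (proj1 CP _ GP) => ->.
- move=> /upP[GF GP _] /upP[HF HP _] GH HG; apply: ann1.
  rewrite rmorphM /= !dv_var (negPf GF) (negPf HF); apply: (ideal_mulr Zid).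
  exact: incompL.
move=> GF /upP[HnF HP FH] GH; apply: ann1.
rewrite rmorphM rmorphXn /= dv_hsum ?not_sub //.
have [->|GnF] := eqVneq G F.
  have := powL (G := F) (H := H); rewrite FP orbT /with_unit eqxx eq_sym (negPf CneqF).
  by rewrite rmorph1 mul1r mulrC; apply.
rewrite (negPf GnF) /= in GF; have [_ GP FG] := upP G GF.
apply: (ideal_mulr Zid); rewrite /with_unit (negPf GnF) dv_var (negPf GnF).
have := powL (G := G) (H := H); rewrite GP orbT /with_unit.
case: eqP FG => [->|_ _]; last exact.
by move=> /proper_trans/(_ CF); rewrite properxx.
Qed.

Let dv_mono (m : mono) : m (enum_rank F) = 0%N -> drop_var 'X_[m] = 'X_[m].
Proof.
move=> mF; rewrite (@svar_msupp m _ drop_var (idfun : {rmorphism S -> S})) // => i mi.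
have -> : 'X_i = svar (enum_val i) by rewrite /svar enum_valK.
rewrite /= dv_var; case: eqP => // e.
by move: mi; rewrite -(enum_valK i) e mF.
Qed.

Lemma slice_value j (m : mono) : m (enum_rank F) = 0%N ->
  slice j 'X_[m] = L 'X_[(U_(enum_rank F) *+ j + m)%MM].
Proof. by move=> mF; rewrite /slice dv_mono // mpolyXD -mpolyXn mulrC. Qed.

(** The power relation at [F] is monic in the variable of [F], so it expresses every slice of index
    at least [r F - r C] through lower ones. *)
Lemma slices_eq0 : (forall j, (j < r F - r C)%N -> forall p, slice j p = 0) ->
  forall p, L p = 0.
Proof.
set c := (r F - r C)%N => small.
have all0 j p : slice j p = 0.
  elim/ltn_ind: j p => j IH p; have [/small//|cj] := ltnP j c.
  rewrite /slice -(subnK cj) exprD.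
  have := powL (G := C) (H := F); rewrite eqxx FP /with_unit eqxx mul1r -/c.
  move/(_ isT isT CF (drop_var p * svar F ^+ (j - c))).
  rewrite hsumF addrC exprDn big_ord_recr /= subnn mul1r binn mulr1n mulrDr.
  rewrite linD // mulrA => e; rewrite -[RHS]e mulr_sumr lin_sum // big1 ?add0r // => i _.
  rewrite -mulrnAr -scaler_nat mulrA -scalerAr linZ //.
  rewrite (_ : _ * svar F ^+ i = drop_var (p * tailsum svar ^+ (c - i)) * svar F ^+ (j - c + i)).
    by rewrite -/(slice _ _) IH ?mulr0 //; have := ltn_ord i; lia.
  rewrite rmorphM rmorphXn /= dv_tail exprD; ring.
apply: lin_mpoly0 => // m.
(* A monomial is a power of the variable of [F] times a monomial free of it, so its value is that of
   a slice. *)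
have -> : m = (U_(enum_rank F) *+ m (enum_rank F) +
              [multinom if i == enum_rank F then 0 else m i | i < N])%MM.
  apply/mnmP => i; rewrite mnmDE mulmnE mnm1E mnmE.
  by case: (eqVneq i (enum_rank F)) => [->|/negPf i0]; rewrite ?eqxx ?mul1n ?addn0 // eq_sym i0.
by rewrite -slice_value ?all0 // mnmE eqxx.
Qed.
End Restrict.
End Step.
End Functionals.
Arguments svar {n} F.

(** * Independence and spanning of the Feichtner-Yuzvinsky monomials *)

Section FYBasis.
Variables (n : nat) (r : {set 'I_n} -> nat).
Hypothesis rM : is_matroid r.
Implicit Types C F G H K : {set 'I_n}.
Implicit Types P : {set {set 'I_n}}.

Local Notation N := #|{: {set 'I_n}}|.
Local Notation S := {mpoly rat[N]}.
Local Notation mono := 'X_{1..N}.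

Lemma flat_rank_lt C F : is_flat r C -> C \proper F -> (r C < r F)%N.
Proof.
move=> fC CF; apply: (@flat_in_lt n r rM setT) CF _; last exact: subsetT.
by rewrite flat_inT.
Qed.

Lemma flats_above_ind (Q : {set 'I_n} -> Prop) :
  (forall C, is_flat r C -> (forall F, is_flat r F -> C \proper F -> Q F) -> Q C) ->
  forall C, is_flat r C -> Q C.
Proof.
move=> QS C; elim: {C}_.+1 {-2}C (ltnSn #|~: C|) => // k IH C cC fC.
apply: QS => // F fF CF; apply: IH => //.
apply: leq_trans (proper_card _) cC.
by rewrite properC.
Qed.

Lemma notin_flats_above F : F \notin flats_above r F.
Proof. by rewrite inE properxx andbF. Qed.

(** Independence of the monomials. The outer induction goes down from the largest [C], the inner one
    adds flats to [P]. *)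
Lemma chow_functional_exists C P (g : mono -> rat) :
  is_flat r C -> flat_filter r C P ->
  exists2 L, chow_functional r C P L & forall m, FY r C P m -> L 'X_[m] = g m.
Proof.
move=> fC; elim/flats_above_ind: C / fC P g => C fC IHC P g CP.
elim/(@filter_min_ind n r C): P / CP g => [|P F CP CPF FP Fmin upF IHP] g.
  (* Without flats the ring is the field of constants and the only monomial is 1. *)
  exists (fun p => p@_0%MM * g 0%MM) => [|m].
    split=> [a u v|]; first by rewrite mcoeffD mcoeffZ mulrDl mulrA.
    split=> [G _ p|G H|G H _]; rewrite ?inE //.
    by rewrite rmorphM /= /svar mcoeffX mnm1_eq0 mulr0 mul0r.
  by case=> [|F j m']; rewrite ?inE // mcoeffX eqxx mul1r.
have [fF CF] := proj1 CP _ FP.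
have [L0 L0rel L0g] := IHP g.
pose c := (r F - r C).-1.
have rc : c.+1 = (r F - r C)%N by rewrite prednK // subn_gt0 flat_rank_lt.
have exF (j : 'I_c.+1) : exists2 L : S -> rat,
    chow_functional r F (flats_above r F) L &
    forall m, FY r F (flats_above r F) m -> L 'X_[m] = g (U_(enum_rank F) *+ j + m)%MM.
  exact: (IHC F fF CF _ (fun m => g (U_(enum_rank F) *+ j + m)%MM) (flats_above_filter r F)).
have [LF LFrel LFg] := fin_all_exists2 exF.
(* [L0] takes care of the monomials that do not start at [F], and [LF j] of those starting with the
   [j]-th power of its variable. *)
pose phi (j : 'I_c.+1) := if j == ord0 then L0 else LF j.
have phiS j : j != ord0 -> chow_functional r F (flats_above r F) (phi j).
  by rewrite /phi => /negPf ->.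
have phi0 : chow_functional r C (P :\ F) (phi ord0) by [].
have val := extend_value phi0 phiS.
eexists; first exact: (extend_chow_functional rM CP CPF FP Fmin upF rc (phi := phi)).
move=> m mP; have smallP m' : FY r C (P :\ F) m' -> m' (enum_rank F) = 0%N.
  by move=> m'P; apply: (FY_support CPF m'P); rewrite !inE eqxx.
have val0 m' : FY r C (P :\ F) m' ->
    rem_functional (\sum_(K : {set 'I_n} | F \proper K) svar K) phi (split_var F 'X_[m']) = g m'.
  move=> m'P; have := val ord0 m' (smallP _ m'P).
  by rewrite mulm0n add0m => ->; apply: L0g.
case: mP => [|G j m' GP /andP[j0 jG] m'P]; first exact/val0/FY0.
have [GF|GF] := eqVneq G F; last first.
  by apply/val0/FYS; rewrite ?inE ?GF ?j0.
rewrite {}GF -rc in j0 jG m'P *.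
rewrite (val (Ordinal jG)); last first.
  apply: (FY_support (flats_above_filter r F) m'P); exact: notin_flats_above.
by rewrite /phi -val_eqE /= (gtn_eqF j0) LFg.
Qed.

(** Spanning of the monomials, by the same double induction applied to the slices. *)
Lemma chow_functional_eq0 C P (L : S -> rat) :
  is_flat r C -> flat_filter r C P -> chow_functional r C P L ->
  (forall m, FY r C P m -> L 'X_[m] = 0) -> forall p, L p = 0.
Proof.
move=> fC; elim/flats_above_ind: C / fC P L => C fC IHC P L CP.
elim/(@filter_min_ind n r C): P / CP L => [|P F CP CPF FP Fmin upF IHP] L Lrel L0.
  have [linL [kill _ _]] := Lrel.
  apply: lin_mpoly0 => // m; have [->|m0] := eqVneq m 0%MM; first exact/L0/FY0.
  have [i mi] : exists i, m i != 0%N.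
    apply/existsP; apply: contraNT m0; rewrite negb_exists => /forallP m0.
    by apply/eqP/mnmP => i; rewrite mnm0E; apply/eqP; rewrite -[_ == _]negbK.
  have le : (U_(i) <= m)%MM.
    apply/mnm_lepP => j; rewrite mnm1E; case: eqP => // <-; by rewrite lt0n.
  rewrite -(submK le) mpolyXD -(enum_valK i); apply: kill; by rewrite inE.
have [fF CF] := proj1 CP _ FP.
apply: (slices_eq0 CP FP upF Lrel) => -[_|j jF] p.
  apply: (IHP (slice F L 0)) => [|m mP]; first exact: (slice0_functional CP FP Fmin Lrel).
  rewrite slice_value ?mulm0n ?add0m; last first.
    by apply: (FY_support CPF mP); rewrite !inE eqxx.
  by apply: L0; apply: FY_mono mP; apply: subsetDl.
apply: (IHC F fF CF _ (slice F L j.+1) (flats_above_filter r F)) => [|m mP].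
  exact: (sliceS_functional CP FP Fmin upF Lrel).
rewrite slice_value ?L0 //; first exact: FYS.
apply: (FY_support (flats_above_filter r F) mP); exact: notin_flats_above.
Qed.
End FYBasis.

(** * Chow polynomials of minors and their monomial bases *)

Section ChowPoly.
Variables (R : idomainType) (n : nat) (r : {set 'I_n} -> nat).
Hypothesis rM : is_matroid r.
Implicit Types C E F G : {set 'I_n}.

Definition inner_powers a : {poly R} := \sum_(1 <= j < a) 'X^j.

(** Counts Feichtner-Yuzvinsky monomials by degree, split by their first flat and its exponent. The
    counter is fuel: each step enlarges [C], so [#|E :\: C|] suffices. *)
Fixpoint chowpoly_rec k E C : {poly R} :=
  if k is k'.+1 then
    1 + \sum_(F : {set 'I_n} | flat_in r E F && (C \proper F))
          inner_powers (r F - r C) * chowpoly_rec k' E F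
  else 1.

(* The Chow polynomial of the minor [(M | E) / C]. *)
Definition chowpoly E C := chowpoly_rec #|E :\: C| E C.

Lemma cardsD_proper E C F : F \subset E -> C \proper F -> (#|E :\: F| < #|E :\: C|)%N.
Proof.
move=> FE /properP[CF [x xF xC]]; apply/proper_card/properP; split; first exact: setDS.
by exists x; rewrite !inE ?xF ?xC // (subsetP FE).
Qed.

Lemma chowpoly_recE k E C : (#|E :\: C| <= k)%N -> chowpoly_rec k E C = chowpoly E C.
Proof.
suff W l : (#|E :\: C| <= k)%N -> (#|E :\: C| <= l)%N ->
    chowpoly_rec k E C = chowpoly_rec l E C by move=> le; apply: W.
elim: k l C => [|k IH] [|l] C //=.
- rewrite leqn0 cards_eq0 => /eqP e0 _; rewrite big1 ?addr0 // => F /andP[/flat_in_sub FE CF].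
  by have := cardsD_proper FE CF; rewrite e0 cards0.
- move=> _; rewrite leqn0 cards_eq0 => /eqP e0.
  rewrite big1 ?addr0 // => F /andP[/flat_in_sub FE CF].
  by have := cardsD_proper FE CF; rewrite e0 cards0.
move=> ck cl; congr (1 + _); apply: eq_bigr => F /andP[/flat_in_sub FE CF].
by rewrite (IH l) //; rewrite -ltnS; apply: leq_trans (cardsD_proper FE CF) _.
Qed.

Lemma chowpolyE E C : chowpoly E C =
  1 + \sum_(F : {set 'I_n} | flat_in r E F && (C \proper F))
        inner_powers (r F - r C) * chowpoly E F.
Proof.
rewrite -(chowpoly_recE (leqnSn _)) /=; congr (1 + _); apply: eq_bigr => F.
by move=> /andP[/flat_in_sub FE CF]; rewrite chowpoly_recE // ltnW // cardsD_proper.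
Qed.

Lemma inner_powersE a : (0 < a)%N -> ('X - 1) * inner_powers a = 'X^a - 'X.
Proof.
case: a => // a _; rewrite /inner_powers big_add1 /= big_mkord.
under eq_bigr do rewrite exprS.
by rewrite -mulr_sumr mulrCA -subrX1 mulrBr mulr1 -exprS.
Qed.

(** The recursion multiplied by ['X - 1], which sums the geometric series; the term [F = C] has
    factor [1 - 'X] and absorbs the left side. *)
Lemma chowpoly_flat_sum E C : flat_in r E C ->
  \sum_(F : {set 'I_n} | flat_in r E F && (C \subset F))
     ('X^(r F - r C) - 'X) * chowpoly E F = 1 - 'X.
Proof.
move=> fC; rewrite (bigD1 C) ?fC ?subxx //= subnn expr0.
rewrite (eq_bigl (fun F => flat_in r E F && (C \proper F))) => [|F]; last first.
  by rewrite properEneq eq_sym andbA andbAC.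
have -> : \sum_(F : {set 'I_n} | flat_in r E F && (C \proper F))
    ('X^(r F - r C) - 'X) * chowpoly E F = ('X - 1) * (chowpoly E C - 1).
  rewrite [in RHS]chowpolyE addrAC subrr add0r mulr_sumr; apply: eq_bigr => F /andP[fF CF].
  rewrite mulrA inner_powersE // subn_gt0.
  exact: (flat_in_lt rM fC CF (flat_in_sub fF)).
ring.
Qed.

(** The maximum with 1 covers rank zero, where the polynomial is 1. *)
Lemma size_chowpoly E C : flat_in r E C -> (size (chowpoly E C) <= maxn 1 (r E - r C))%N.
Proof.
elim: {C}_.+1 {-2}C (ltnSn #|E :\: C|) => // k IH C cC fC; rewrite chowpolyE.
apply: leq_trans (size_polyD _ _) _; rewrite size_poly1 geq_max leq_maxl /=.
apply: leq_trans (size_sum _ _ _) _; apply/bigmax_leqP => F /andP[fF CF].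
have FE := flat_in_sub fF; have CFE := cardsD_proper FE CF.
have rCF := flat_in_lt rM fC CF FE; have rFE := rank_mono rM FE.
apply: leq_trans (size_polyMleq _ _) _.
have := IH F (leq_trans CFE cC) fF.
have: (size (inner_powers (r F - r C)) <= r F - r C)%N.
  apply: leq_trans (size_sum _ _ _) _; apply/bigmax_leqP_seq => j.
  by rewrite mem_index_iota size_polyXn => /andP[_].
move: (r F) (r C) (r E) rCF rFE (size _) (size (chowpoly E F)) => f c e cf fe a b.
move: cf fe; clear; lia.
Qed.
End ChowPoly.

(** * Counting the Feichtner-Yuzvinsky monomials by degree *)

Section FYEnumeration.
Variables (R : idomainType) (n : nat) (r : {set 'I_n} -> nat).
Hypothesis rM : is_matroid r.
Implicit Types C E F G : {set 'I_n}.
Local Notation N := #|{: {set 'I_n}}|.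
Local Notation mono := 'X_{1..N}.

Definition fy_heads C : seq ({set 'I_n} * nat) :=
  [seq (F, j) | F <- enum (flats_above r C), j <- iota 1 (r F - r C).-1].

Fixpoint fy_seq k C : seq mono :=
  if k is k'.+1 then
    0%MM :: [seq (U_(enum_rank p.1) *+ p.2 + m)%MM | p <- fy_heads C, m <- fy_seq k' p.1]
  else [:: 0%MM].

Lemma mem_fy_heads C F j :
  ((F, j) \in fy_heads C) = (F \in flats_above r C) && (0 < j < r F - r C)%N.
Proof.
apply/allpairsPdep/idP => [[F' [j' [+ + [-> ->]]]]|/andP[FC jF]].
  by rewrite mem_enum mem_iota => -> /=; lia.
by exists F, j; rewrite mem_enum FC mem_iota; split=> //; lia.
Qed.

Lemma card_setC_proper C F : C \proper F -> (#|~: F| < #|~: C|)%N.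
Proof. by move=> CF; apply: proper_card; rewrite properC. Qed.

Lemma mem_fy_seq k C m : (#|~: C| <= k)%N ->
  (m \in fy_seq k C) <-> FY r C (flats_above r C) m.
Proof.
have upC F C' k' : (#|~: C'| <= k'.+1)%N -> F \in flats_above r C' -> (#|~: F| <= k')%N.
  rewrite inE -ltnS => le /andP[_ /card_setC_proper lt]; exact: leq_trans lt le.
elim: k C m => [|k IH] C m cC.
  rewrite /= inE; split=> [/eqP->|]; first exact: FY0.
  case=> // F j m'; rewrite inE => /andP[_ /card_setC_proper].
  by move: cC; rewrite leqn0 => /eqP->.
rewrite /= inE; split.
  case/predU1P=> [->|/allpairsPdep[[F j] [m' [/=]]]]; first exact: FY0.
  rewrite mem_fy_heads => /andP[FC jF] m'F ->; apply: FYS => //.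
  by apply/IH => //; apply: upC FC.
case=> [|F j m' FC jF m'F]; first by rewrite eqxx.
apply/orP; right; apply/allpairsPdep; exists (F, j), m'.
rewrite mem_fy_heads FC; split=> //.
by apply/IH => //; apply: upC FC.
Qed.

(** A monomial determines its first flat: two candidates would each lie properly above the other.
    The exponent there is then determined, since the tail is supported strictly above that flat. *)
Lemma fy_seq_uniq k C : (#|~: C| <= k)%N -> uniq (fy_seq k C).
Proof.
elim: k C => [|k IH] C cC //=.
have upC p : p \in fy_heads C -> (#|~: p.1| <= k)%N.
  case: p => F j; rewrite mem_fy_heads inE => /andP[/andP[_ /card_setC_proper lt] _].
  by rewrite -ltnS; apply: leq_trans lt cC.
have supp p m : p \in fy_heads C -> m \in fy_seq k p.1 ->
    forall G, G \notin flats_above r p.1 -> m (enum_rank G) = 0%N.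
  move=> pC mp G; apply: FY_support (flats_above_filter r p.1) _.
  by apply/(mem_fy_seq _ (upC p pC)).
apply/andP; split.
  apply/negP => /allpairsPdep[[F j] [m [/=]]].
  rewrite mem_fy_heads => /andP[_ /andP[j0 _]] _ /(congr1 (fun m : mono => m (enum_rank F))).
  by rewrite mnm0E mnmDE mulmnE mnm1E eqxx; lia.
apply: allpairs_uniq_dep => [|p /upC /IH //|].
  apply: allpairs_uniq_dep => [|F _|]; rewrite ?enum_uniq ?iota_uniq //.
  by move=> [F j] [F' j'] _ _ /= [-> ->].
move=> [p m] [q m'] /allpairsPdep[p1 [m1 [pC mp e1]]] /allpairsPdep[q1 [m2 [qC mq e2]]].
have /= [ep em] := congr1 (fun u : {_ : _ & mono} => (tag u, tagged u)) e1.
have /= [eq em'] := congr1 (fun u : {_ : _ & mono} => (tag u, tagged u)) e2.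
rewrite -{}ep -{}em in pC mp *; rewrite -{}eq -{}em' in qC mq * => {p1 m1 q1 m2 e1 e2}.
case: p q pC mp qC mq => [F j] [G l] FC mF GC mG /= e.
have [jF lG] : (0 < j)%N /\ (0 < l)%N.
  by move: FC GC; rewrite !mem_fy_heads => /andP[_ /andP[-> _]] /andP[_ /andP[-> _]].
have FG : F = G.
  apply/eqP/negPn/negP => FG.
  have FupG : F \in flats_above r G.
    apply/negPn/negP => nF; have := congr1 (fun m : mono => m (enum_rank F)) e.
    rewrite !mnmDE !mulmnE !mnm1E eqxx (supp _ _ GC mG F nF).
    rewrite (inj_eq enum_rank_inj) eq_sym (negPf FG); lia.
  have GupF : G \in flats_above r F.
    apply/negPn/negP => nG; have := congr1 (fun m : mono => m (enum_rank G)) e.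
    rewrite !mnmDE !mulmnE !mnm1E eqxx (supp _ _ FC mF G nG).
    rewrite (inj_eq enum_rank_inj) (negPf FG); lia.
  move: FupG GupF; rewrite !inE => /andP[_ GF] /andP[_ /(proper_trans GF)].
  by rewrite properxx.
rewrite -{}FG in GC mG e *.
have jl : j = l.
  have := congr1 (fun m : mono => m (enum_rank F)) e.
  rewrite !mnmDE !mulmnE !mnm1E eqxx.
  rewrite (supp _ _ FC mF F (notin_flats_above r F)) (supp _ _ GC mG F (notin_flats_above r F)).
  by rewrite !mul1n !addn0.
by rewrite -{}jl in e *; rewrite (addmI e).
Qed.

Lemma fy_seq_chowpoly k C : (#|~: C| <= k)%N ->
  \sum_(m <- fy_seq k C) 'X^(mdeg m) = chowpoly R r setT C.
Proof.
elim: k C => [|k IH] C cC /=.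
  rewrite big_seq1 mdeg0 expr0 /chowpoly -setTD in cC *.
  by move: cC; rewrite leqn0 => /eqP ->.
rewrite big_cons mdeg0 expr0 chowpolyE; congr (1 + _).
rewrite big_allpairs_dep /= big_allpairs_dep /= big_enum /=.
apply: eq_big => [F|F FC]; first by rewrite inE flat_inT.
rewrite /inner_powers mulr_suml /index_iota subn1 big_seq_cond [RHS]big_seq_cond.
apply: eq_bigr => j _; rewrite -IH; last first.
  by move: FC; rewrite inE => /andP[_ /card_setC_proper lt]; rewrite -ltnS; apply: leq_trans lt cC.
rewrite mulr_sumr; apply: eq_bigr => m _.
by rewrite mdegD mdegMn mdeg1 mul1n exprD.
Qed.

Lemma count_fy_seq C i :
  (count (fun m => mdeg m == i) (fy_seq #|~: C| C))%:R = (chowpoly R r setT C)`_i.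
Proof.
rewrite -(fy_seq_chowpoly (leqnn _)) coef_sum -sum1_count natr_sum big_mkcond /=.
by apply: eq_bigr => m _; rewrite coefXn eq_sym; case: eqP.
Qed.
End FYEnumeration.

(** * Transfer to the ring presented without the ground set variable *)

Section LinearForms.
Variables (n : nat) (r : {set 'I_n} -> nat).
Hypotheses (rM : is_matroid r) (rL : loopless r).
Implicit Types G H K : {set 'I_n}.

Lemma loopless_flat0 : is_flat r set0.
Proof.
apply/forallP => x; apply/implyP => _.
by rewrite rank_set0 // setU0 rL.
Qed.

Lemma mem_flats_above0 G : (G \in flats_above r set0) = is_flat r G && (G != set0).
Proof. by rewrite inE proper0. Qed.

Lemma hsum1_split (A : nmodType) (y : {set 'I_n} -> A) i :
  hsum y [set i] = y setT + \sum_(F : NPF r | i \in val F) y (val F) +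
    \sum_(K : {set 'I_n} | [&& i \in K, K != setT & ~~ npflat r K]) y K.
Proof.
rewrite /hsum (bigD1 setT) ?subsetT //= -addrA; congr (_ + _).
rewrite (bigID (npflat r)) /=; congr (_ + _); last first.
  by apply: eq_bigl => K; rewrite sub1set andbA.
rewrite (reindex_omap (val : NPF r -> {set 'I_n}) insub) /=; last first.
  by move=> K /andP[_ KF]; rewrite insubT.
apply: eq_bigl => F; rewrite valK eqxx andbT sub1set (valP F) andbT andb_idr //.
by case/and3P: (valP F).
Qed.

(** A converse to [linear_rels]: the closure of [i] has rank one, so its power relation is
    linear. *)
Lemma rels_hsum1 (A : comNzRingType) (Z : A -> Prop) (y : {set 'I_n} -> A) i :
  ideal_pred Z -> chow_rels r Z y set0 (flats_above r set0) -> Z (hsum y [set i]).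
Proof.
move=> Zid [kill incomp pow]; have CP := flats_above_filter r set0.
have n0 : ~~ ([set i] \subset set0) by rewrite sub1set inE.
have := with_unit_mul_hsum rM Zid CP kill incomp (G := set0) (H := [set i]).
rewrite /with_unit eqxx mul1r set0U => /(_ isT n0) d.
apply: (ideal_congr Zid d).
have clP : mcl r [set i] \in flats_above r set0.
  rewrite mem_flats_above0 mcl_flat //=; apply: contraTneq (sub_mcl r [set i]) => ->.
  exact: n0.
have := pow set0 (mcl r [set i]).
rewrite clP eqxx /with_unit eqxx mul1r rank_mcl // rank_set0 // subn0 rL expr1; apply=> //.
by move: clP; rewrite inE => /andP[].
Qed.
End LinearForms.

(** An endomorphism that fixes constants and fixes variables modulo an ideal is the identity modulo
    that ideal. *)
Lemma ideal_rmorph_congr m (Z : {mpoly rat[m]} -> Prop)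
    (e : {rmorphism {mpoly rat[m]} -> {mpoly rat[m]}}) :
  ideal_pred Z -> (forall c, e c%:MP = c%:MP) -> (forall i, Z ('X_i - e 'X_i)) ->
  forall p, Z (p - e p).
Proof.
move=> Zid eC eX.
have mulZ u u' v v' : Z (u - u') -> Z (v - v') -> Z (u * v - u' * v').
  move=> Zu Zv; rewrite (_ : _ - _ = (u - u') * v + u' * (v - v')); last by ring.
  by apply: (ideal_add Zid); [apply: (ideal_mulr Zid)|apply: (ideal_mull Zid)].
have Zrefl u : Z (u - u) by rewrite subrr; apply: ideal_zero.
elim/mpolyind => [|a l p _ _ IH]; first by rewrite rmorph0.
rewrite rmorphD opprD addrACA; apply: (ideal_add Zid) IH.
rewrite -mul_mpolyC rmorphM eC; apply: (mulZ _ _ _ _ (Zrefl _)).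
rewrite mpolyXE_id rmorph_prod.
apply: (big_ind2 (fun u u' => Z (u - u'))); [exact: Zrefl|by move=> *; apply: mulZ|move=> i _].
rewrite rmorphXn; elim: (l i) => [|k IHk]; first exact: Zrefl.
by rewrite !exprS; apply: mulZ.
Qed.

Section Transfer.
Variables (n : nat) (r : {set 'I_n} -> nat).
Hypotheses (rM : is_matroid r) (rL : loopless r).
Variables (i0 : 'I_n).
Implicit Types G H K : {set 'I_n}.
Local Notation N := #|{: {set 'I_n}}|.
Local Notation S := {mpoly rat[N]}.
Local Notation Sc := {mpoly rat[nvar r]}.
Local Notation up0 := (flats_above r set0).

Let linform i : Sc := \sum_(F : NPF r | i \in val F) xF F.

(* The ring [Sc] has no variable for the ground set; the linear relations force
   [x_E = - sum_(F : i0 \in F) x_F]. *)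
Definition chow_var G : Sc :=
  if insub G is Some F then xF F else if G == setT then - linform i0 else 0.

Definition to_chow : S -> Sc := mmap (@mpolyC (nvar r) rat) (fun i => chow_var (enum_val i)).
HB.instance Definition _ := GRing.RMorphism.on to_chow.
Definition of_chow : Sc -> S := mmap (@mpolyC N rat) (fun j => svar (val (enum_val j))).
HB.instance Definition _ := GRing.RMorphism.on of_chow.

Lemma to_chow_var G : to_chow (svar G) = chow_var G.
Proof. by rewrite /to_chow mmapX mmap1U enum_rankK. Qed.

Lemma of_chow_var F : of_chow (xF F) = svar (val F).
Proof. by rewrite /of_chow /xF mmapX mmap1U enum_rankK. Qed.

Lemma chow_var_val F : chow_var (val F) = xF F.
Proof. by rewrite /chow_var valK. Qed.

Lemma npflatT : npflat r setT = false.
Proof. by rewrite /npflat eqxx !andbF. Qed.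

Lemma chow_varT : chow_var setT = - linform i0.
Proof. by rewrite /chow_var insubF ?npflatT // eqxx. Qed.

Lemma chow_var0 K : K != setT -> ~~ npflat r K -> chow_var K = 0.
Proof. by move=> /negPf KT /negPf K0; rewrite /chow_var insubF // KT. Qed.

Lemma up0P G : (G \in up0) = npflat r G || (G == setT).
Proof.
rewrite mem_flats_above0 /npflat; have [->|GT] := eqVneq G setT; last first.
  by rewrite andbT orbF.
rewrite orbT -flat_inT // flat_in_refl /=; apply/set0Pn; by exists i0; rewrite inE.
Qed.

Lemma to_chow_linear a u v : to_chow (a *: u + v) = a *: to_chow u + to_chow v.
Proof. by rewrite -mul_mpolyC rmorphD rmorphM /= {1}/to_chow mmapC mul_mpolyC. Qed.

Lemma of_chow_linear a u v : of_chow (a *: u + v) = a *: of_chow u + of_chow v.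
Proof. by rewrite -mul_mpolyC rmorphD rmorphM /= {1}/of_chow mmapC mul_mpolyC. Qed.

Definition chow_killed (l : Sc -> rat) :=
  (forall (p : Sc) (F G : NPF r), incomparable F G -> l (p * (xF F * xF G)) = 0) /\
  (forall (p : Sc) i j, l (p * (linform i - linform j)) = 0).

(** The image of [hsum svar [set i]] under [to_chow] is a difference of two linear forms, hence
    killed; [linear_rels] supplies the power relations. *)
Lemma chow_killed_functional l : lin l -> chow_killed l ->
  chow_functional r set0 up0 (l \o to_chow).
Proof.
move=> linl [kq kl]; have linL : lin (l \o to_chow).
  by move=> a u v; rewrite /= to_chow_linear linl.
split=> //; apply: linear_rels => //; first exact: annihilator_ideal.
- exact: loopless_flat0.
- move=> G; rewrite up0P negb_or => /andP[GF GT] p /=.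
  by rewrite rmorphM /= to_chow_var chow_var0 // mulr0 (lin0 linl).
- move=> G H; rewrite !up0P => GP HP GH HG p /=; rewrite rmorphM rmorphM /= !to_chow_var.
  have GF : npflat r G.
    by case/orP: GP => // /eqP e; rewrite e subsetT in HG.
  have HF : npflat r H.
    by case/orP: HP => // /eqP e; rewrite e subsetT in GH.
  rewrite -[G]/(val (Sub G GF : NPF r)) -[H]/(val (Sub H HF : NPF r)) !chow_var_val.
  by apply: kq; rewrite /incomparable GH HG.
move=> i p /=; rewrite rmorphM /=.
suff -> : to_chow (hsum svar [set i]) = linform i - linform i0 by [].
transitivity (hsum chow_var [set i]).
  by rewrite /hsum rmorph_sum; apply: eq_bigr => K _; apply: to_chow_var.
rewrite (hsum1_split r) chow_varT [X in _ + X]big1 ?addr0 => [|K /and3P[_ KT KF]]; last first.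
  exact: chow_var0.
by rewrite addrC; congr (_ - _); apply: eq_bigr => F _; rewrite chow_var_val.
Qed.

(** Modulo the relations every linear form equals minus the variable of the ground set, whatever [i]
    is. *)
Lemma of_chow_linform i (Z : S -> Prop) : ideal_pred Z -> chow_rels r Z svar set0 up0 ->
  Z (of_chow (linform i) + svar setT).
Proof.
move=> Zid rels; have := rels_hsum1 rM rL i Zid rels.
rewrite (hsum1_split r) => h; apply: (ideal_congr Zid) h.
rewrite rmorph_sum (eq_bigr _ (fun F _ => of_chow_var F)) [X in X - _]addrC opprD addrA subrr add0r.
apply: (ideal_opp Zid); apply: (ideal_sum Zid) => K /and3P[_ KT KF].
by case: rels => kill _ _; apply: kill; rewrite up0P negb_or KF KT.
Qed.

Lemma functional_chow_killed L : chow_functional r set0 up0 L -> chow_killed (L \o of_chow).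
Proof.
move=> [linL rels]; have Zid := annihilator_ideal linL; split=> [p F G|p i j] /=.
  case/andP=> FG GF; rewrite !rmorphM /= !of_chow_var.
  case: rels => _ incomp _; apply: incomp => //; rewrite up0P; apply/orP; left; exact: valP.
rewrite rmorphM rmorphB /=.
rewrite -(addrKA (svar setT)) [svar setT + _]addrC.
by apply: (ideal_sub Zid); apply: of_chow_linform.
Qed.

(** Eliminating the ground set variable and returning changes a polynomial only by elements of the
    annihilator. *)
Lemma of_to_chow L : chow_functional r set0 up0 L -> forall p, L (of_chow (to_chow p)) = L p.
Proof.
move=> [linL rels]; have Zid := annihilator_ideal linL.
have eC c : of_chow (to_chow c%:MP) = c%:MP by rewrite /to_chow /of_chow !mmapC.
have W : forall p, annihilator L (p - (of_chow \o to_chow : {rmorphism S -> S}) p).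
  apply: (@ideal_rmorph_congr _ (annihilator L)
    (of_chow \o to_chow : {rmorphism S -> S}) Zid eC) => i /=.
  have -> : 'X_i = svar (enum_val i) by rewrite /svar enum_valK.
  move: (enum_val i) => G; rewrite to_chow_var.
  have [GF|GF] := boolP (npflat r G).
    rewrite -[G]/(val (Sub G GF : NPF r)) chow_var_val of_chow_var subrr.
    exact: (ideal_zero Zid).
  have [->|GT] := eqVneq G setT.
    by rewrite chow_varT rmorphN opprK addrC; apply: of_chow_linform.
  rewrite chow_var0 // rmorph0 subr0; case: rels => kill _ _.
  by apply: kill; rewrite up0P negb_or GF GT.
move=> p; apply/eqP; rewrite eq_sym -subr_eq0; apply/eqP.
have := W p 1; rewrite mul1r => <-.
by rewrite -[- L _]mulN1r -(linZ linL) scaleN1r -(linD linL).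
Qed.

Lemma to_of_chow_mono (m : 'X_{1..nvar r}) : to_chow (of_chow 'X_[m]) = 'X_[m].
Proof.
rewrite mpolyXE_id !rmorph_prod; apply: eq_bigr => j _; rewrite !rmorphXn /=.
have -> : 'X_j = xF (enum_val j) by rewrite /xF enum_valK.
by rewrite of_chow_var to_chow_var chow_var_val.
Qed.

Lemma xF_homog (F : NPF r) : xF F \is 1.-homog.
Proof. by rewrite dhomogX /= mdeg1. Qed.

Lemma linform_homog i : linform i \is 1.-homog.
Proof. by apply: rpred_sum => F _; apply: xF_homog. Qed.

Lemma to_chow_homog (m : 'X_{1..N}) : to_chow 'X_[m] \is (mdeg m).-homog.
Proof.
rewrite /to_chow mmapX /mmap1 mdegE.
elim/big_rec2: _ => [|i d p _ IH]; first exact: dhomog1.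
apply: dhomogM IH; rewrite -[X in X.-homog]mul1n; apply: dhomogMn.
rewrite /chow_var; case: insubP => [F _ _|_]; first exact: xF_homog.
by case: eqP => _; rewrite ?rpredN ?linform_homog // dhomog0.
Qed.
End Transfer.

(** * Dimension of the graded pieces *)

Section RankByFunctionals.
Variables (F : fieldType) (g N f : nat) (A : 'M[F]_(g, N)).

(** The columns of [W] are independent in the kernel of [A], giving one inequality; injectivity of
    [A] and [B] stacked gives the other. In the application [A] holds relations, [B] a candidate
    basis and [W] the dual functionals. *)
Lemma rank_complement (B : 'M[F]_(f, N)) (W : 'M[F]_(N, f)) :
  A *m W = 0 -> B *m W = 1%:M ->
  (forall v : 'cV[F]_N, A *m v = 0 -> B *m v = 0 -> v = 0) ->
  (\rank A + f)%N = N.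
Proof.
move=> AW BW inj; apply/eqP; rewrite eqn_leq; apply/andP; split.
  apply: leq_trans (mulmx0_rank_max AW); rewrite leq_add2l.
  by apply: leq_trans (mxrankM_maxr B W); rewrite BW mxrank1.
have free : row_free (col_mx A B)^T.
  rewrite -kermx_eq0; apply/rowV0P => u /sub_kermxP u0.
  apply: trmx_inj; rewrite trmx0; apply: inj.
    have := congr1 (fun M => usubmx M^T) u0.
    by rewrite trmx_mul trmxK mul_col_mx trmx0 col_mxKu => ->; apply/matrixP => i j; rewrite !mxE.
  have := congr1 (fun M => dsubmx M^T) u0.
  by rewrite trmx_mul trmxK mul_col_mx trmx0 col_mxKd => ->; apply/matrixP => i j; rewrite !mxE.
have {}free : N = \rank (A + B)%MS by rewrite addsmxE -mxrank_tr (eqP free).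
rewrite [leqLHS]free; apply: leq_trans (mxrank_adds_leqif A B) _.
by rewrite leq_add2l rank_leq_row.
Qed.
End RankByFunctionals.

Section ChowDim.
Variables (n : nat) (r : {set 'I_n} -> nat).
Hypotheses (rM : is_matroid r) (rL : loopless r).
Variables (i0 : 'I_n) (k : nat).
Local Notation N := #|{: {set 'I_n}}|.
Local Notation S := {mpoly rat[N]}.
Local Notation Sc := {mpoly rat[nvar r]}.
Local Notation bmono := (bmultinom (nvar r) k.+1).

Let D := [pred m : bmono | mdeg m == k].
Let dmono (c : 'I_#|D|) : 'X_{1..nvar r} := bmnm (enum_val c).

Let mdeg_dmono c : mdeg (dmono c) = k.
Proof. by apply/eqP; have := enum_valP c; rewrite inE. Qed.

Let dmono_inj : injective dmono.
Proof. by move=> c c' /val_inj; apply: enum_val_inj. Qed.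

Let dmonoP (m : 'X_{1..nvar r}) : mdeg m = k -> exists c, dmono c = m.
Proof.
move=> mk; have lt : (mdeg m < k.+1)%N by rewrite mk.
have mD : BMultinom lt \in D by rewrite inE /= mk.
by exists (enum_rank_in mD (BMultinom lt)); rewrite /dmono enum_rankK_in.
Qed.

Let homog_expand (q : Sc) : q \is k.-homog -> q = \sum_c q@_(dmono c) *: 'X_[dmono c].
Proof.
move=> hq; apply/mpolyP => m; rewrite raddf_sum /=.
under eq_bigr => c _ do rewrite mcoeffZ mcoeffX.
have [mk|mk] := eqVneq (mdeg m) k.
  have [c <-] := dmonoP mk; rewrite (bigD1 c) //= eqxx mulr1 big1 ?addr0 // => c' cc'.
  by rewrite (inj_eq dmono_inj) (negPf cc') mulr0.
rewrite (dhomog_nemf_coeff hq) // big1 // => c _.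
case: eqP => [e|_]; [by rewrite -e mdeg_dmono eqxx in mk | by rewrite mulr0].
Qed.

Let P : 'M[rat]_(#|{: bmono}|, #|D|) :=
  \matrix_(j, c) (enum_val c == enum_val j :> bmono)%:R.

Let gen_homog g : chow_gen (r := r) (k := k) g \is k.-homog.
Proof.
case: g => [[[m F] G]|[[m i] j]] /=; case: ifP => [|_]; rewrite ?dhomog0 //.
  case/andP=> /eqP mk _; have : 'X_[m] * (xF F * xF G) \is (mdeg m + (1 + 1)).-homog.
    by rewrite !dhomogM ?xF_homog // dhomogX.
  by rewrite mulrA mk.
move=> /eqP mk; have lf l : \sum_(F : NPF r | l \in val F) xF F \is 1.-homog.
  by apply: rpred_sum => F _; apply: xF_homog.
have : 'X_[m] * (\sum_(F : NPF r | i \in val F) xF F - \sum_(F : NPF r | j \in val F) xF F)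
    \is (mdeg m + 1).-homog by rewrite dhomogM ?rpredB ?lf // dhomogX.
by rewrite mk.
Qed.

Let A : 'M[rat]_(#|{: chow_gen_idx r k}|, #|D|) :=
  \matrix_(g, c) (chow_gen (enum_val g))@_(dmono c).

(** The generators are homogeneous of degree [k], so the columns of lower degree are zero and can be
    discarded. *)
Let rank_chow_gen : \rank (chow_gen_mx r k) = \rank A.
Proof.
have AP : A = chow_gen_mx r k *m P.
  apply/matrixP => g c; rewrite !mxE (bigD1 (enum_rank (enum_val c))) //= big1 => [|j jc].
    by rewrite !mxE enum_rankK eqxx mulr1 addr0.
  rewrite !mxE; case: eqP => [e|_]; rewrite ?mulr0 //.
  by rewrite e enum_valK eqxx in jc.
have PA : chow_gen_mx r k = A *m P^T.
  apply/matrixP => g j; rewrite !mxE.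
  under eq_bigr => c _ do rewrite !mxE.
  have [jk|jk] := eqVneq (mdeg (bmnm (enum_val j))) k.
    have [c cj] := dmonoP jk.
    have cj' : enum_val c = enum_val j by apply: val_inj.
    rewrite (bigD1 c) //= big1 => [|c' cc']; first by rewrite cj' eqxx mulr1 addr0 cj.
    rewrite -cj' (inj_eq enum_val_inj) (negPf cc') mulr0 //.
  rewrite (dhomog_nemf_coeff (gen_homog _)) // big1 // => c _.
  case: eqP => [e|_]; rewrite ?mulr0 //; move: jk; rewrite -e.
  by rewrite -/(dmono c) mdeg_dmono eqxx.
by apply/eqP; rewrite eqn_leq {1}PA mxrankM_maxl AP mxrankM_maxl.
Qed.

Let basis := [seq m <- fy_seq r #|~: (set0 : {set 'I_n})| set0 | mdeg m == k].

Let FY_basis m : m \in basis -> FY r set0 (flats_above r set0) m.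
Proof. by rewrite mem_filter => /andP[_]; rewrite mem_fy_seq. Qed.

Let B : 'M[rat]_(size basis, #|D|) :=
  \matrix_(a, c) (to_chow r i0 'X_[nth 0%MM basis a])@_(dmono c).

(** A kernel vector is a functional on forms of degree [k]; extended by zero to other degrees, it
    kills the whole homogeneous ideal. *)
Let A_killed (v : 'cV[rat]_#|D|) : A *m v = 0 ->
  chow_killed (fun q : Sc => \sum_c q@_(dmono c) * v c 0).
Proof.
move=> Av; set l := fun q : Sc => _.
have linl : lin l.
  move=> a u w; rewrite /l mulr_sumr -big_split /=; apply: eq_bigr => c _.
  by rewrite mcoeffD mcoeffZ mulrDl mulrA.
have gen0 g : l (chow_gen (r := r) (k := k) g) = 0.
  have := congr1 (fun M : 'cV__ => M (enum_rank g) 0) Av; rewrite !mxE => <-.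
  by apply: eq_bigr => c _; rewrite !mxE enum_rankK.
have homog0 d q : q \is d.-homog -> d != k -> l q = 0.
  move=> hq dk; rewrite /l big1 // => c _.
  by rewrite (dhomog_nemf_coeff hq) ?mul0r //= mdeg_dmono eq_sym.
have ext q : (forall m, l ('X_[m] * q) = 0) -> forall p, l (p * q) = 0.
  move=> lq; elim/mpolyind => [|a m p _ _ IH]; first by rewrite mul0r (lin0 linl).
  by rewrite mulrDl -scalerAl linl lq IH mulr0 addr0.
split=> [p F G FG|p i j]; move: p; apply: ext => m.
  have [mk|mk] := eqVneq (mdeg m + 2)%N k; last first.
    apply: homog0 mk; apply: dhomogM; first by rewrite dhomogX.
    by rewrite -[2%N]/(1 + 1)%N; apply: dhomogM; apply: xF_homog.
  have lt : (mdeg m < k.+1)%N by rewrite -mk ltnS leq_addr.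
  by have := gen0 (inl (BMultinom lt, F, G)); rewrite /= mk eqxx FG mulrA.
have [mk|mk] := eqVneq (mdeg m + 1)%N k; last first.
  apply: homog0 mk; apply: dhomogM; first by rewrite dhomogX.
  by apply: rpredB; apply: rpred_sum => F _; apply: xF_homog.
have lt : (mdeg m < k.+1)%N by rewrite -mk ltnS leq_addr.
by have := gen0 (inr (BMultinom lt, i, j)); rewrite /= mk eqxx.
Qed.

(** A functional that also vanishes on the basis monomials is zero by spanning, and each monomial of
    the Chow ring lies in the image of [to_chow]. *)
Let AB_inj (v : 'cV[rat]_#|D|) : A *m v = 0 -> B *m v = 0 -> v = 0.
Proof.
move=> Av Bv; set l := fun q : Sc => \sum_c q@_(dmono c) * v c 0.
have linl : lin l.
  move=> a u w; rewrite /l mulr_sumr -big_split /=; apply: eq_bigr => c _.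
  by rewrite mcoeffD mcoeffZ mulrDl mulrA.
have fun_l := chow_killed_functional rM rL i0 linl (A_killed Av).
have l0 := chow_functional_eq0 (loopless_flat0 rM rL) (flats_above_filter r set0) fun_l.
have {}l0 p : l (to_chow r i0 p) = 0.
  apply: l0 => m mFY /=; have [mk|mk] := eqVneq (mdeg m) k; last first.
    rewrite /l big1 // => c _.
    by rewrite (dhomog_nemf_coeff (to_chow_homog r i0 m)) ?mul0r //= mdeg_dmono eq_sym.
  have mb : m \in basis.
    by rewrite mem_filter mk eqxx mem_fy_seq.
  have lt : (index m basis < size basis)%N by rewrite index_mem.
  have := congr1 (fun M : 'cV__ => M (Ordinal lt) 0) Bv; rewrite !mxE => <-.
  by apply: eq_bigr => c _; rewrite !mxE /= nth_index.
apply/matrixP => c z; rewrite ord1 mxE -(l0 (of_chow 'X_[dmono c])).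
rewrite to_of_chow_mono /l (bigD1 c) //= mcoeffX eqxx mul1r big1 ?addr0 // => c' cc'.
by rewrite mcoeffX (inj_eq dmono_inj) eq_sym (negPf cc') mul0r.
Qed.

Let dual_basis : exists2 W : 'M[rat]_(#|D|, size basis), A *m W = 0 & B *m W = 1%:M.
Proof.
have exL (a : 'I_(size basis)) : exists2 L : S -> rat,
    chow_functional r set0 (flats_above r set0) L &
    forall m, m \in basis -> L 'X_[m] = (m == nth 0%MM basis a)%:R.
  have [L L1 L2] := chow_functional_exists rM
    (fun m => (m == nth 0%MM basis a)%:R) (loopless_flat0 rM rL) (flats_above_filter r set0).
  by exists L => // m /FY_basis /L2.
have [L Lf Lv] := fin_all_exists2 exL.
have expand (a : 'I_(size basis)) q : q \is k.-homog ->
    \sum_c q@_(dmono c) * L a (of_chow 'X_[dmono c]) = L a (of_chow q).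
  move=> hq; have [linL _] := Lf a; rewrite {2}(homog_expand hq).
  rewrite (big_morph _ (id1 := 0) (op1 := +%R) (fun u v => rmorphD _ u v) (rmorph0 _)) /=.
  rewrite (lin_sum linL); apply: eq_bigr => c _.
  have := of_chow_linear (q@_(dmono c)) 'X_[dmono c] 0.
  by rewrite addr0 rmorph0 addr0 => ->; rewrite (linZ linL).
exists (\matrix_(c, a) L a (of_chow 'X_[dmono c])).
  apply/matrixP => g a; rewrite !mxE.
  under eq_bigr => c _ do rewrite !mxE.
  rewrite expand //; have [kq kl] := functional_chow_killed rM rL i0 (Lf a).
  have [linL _] := Lf a.
  case: (enum_val g) => [[[m F] G]|[[m i] j]] /=; case: ifP => [|_];
    rewrite ?rmorph0 ?(lin0 linL) //.
    by case/andP=> _ FG; rewrite -mulrA; apply: kq.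
  by move=> _; apply: kl.
apply/matrixP => a b; rewrite !mxE.
under eq_bigr => c _ do rewrite !mxE.
have ab : nth 0%MM basis a \in basis by apply: mem_nth.
rewrite expand; last first.
  have := to_chow_homog r i0 (nth 0%MM basis a).
  by move: ab; rewrite mem_filter => /andP[/eqP ->].
rewrite (of_to_chow rM rL i0 (Lf b)) Lv // nth_uniq ?filter_uniq ?fy_seq_uniq //.
Qed.

Lemma chow_dim_count : chow_dim r k =
  count (fun m => mdeg m == k) (fy_seq r #|~: (set0 : {set 'I_n})| set0).
Proof.
have [W AW BW] := dual_basis.
have := rank_complement AW BW AB_inj.
by rewrite /chow_dim rank_chow_gen size_filter => rk; rewrite -[X in (X - _)%N]rk addKn.
Qed.
End ChowDim.

(** * The deletion formula *)

Section Deletion.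
Variables (R : idomainType) (n : nat) (r : {set 'I_n} -> nat).
Hypothesis rM : is_matroid r.
Implicit Types C E F G : {set 'I_n}.
Local Notation chowpoly := (chowpoly R r).

Lemma chowpoly_refl E : chowpoly E E = 1.
Proof.
rewrite chowpolyE big1 ?addr0 // => F /andP[/flat_in_sub FE /properP[_ [x xF /negP[]]]].
exact: (subsetP FE).
Qed.

Lemma flat_in_delete E G i : i \in E -> i \in G -> r (G :\ i) = r G ->
  flat_in r (E :\ i) (G :\ i) = flat_in r E G.
Proof.
move=> iE iG rG; have rx x : r (x |: G :\ i) = r (x |: G).
  by rewrite ![x |: _]setUC; apply: (rank_setU_eq rM); rewrite ?subD1set.
apply/flat_inP/flat_inP => -[GE fG]; split.
- by apply/subsetP => x xG; have [->//|xi] := eqVneq x i;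
    have := subsetP GE x; rewrite !inE xi xG => /(_ isT).
- move=> x xE xG; rewrite -rx -rG; apply: fG; rewrite !inE ?xE ?(negPf xG) ?andbF // andbT.
  by apply: contraNneq xG => ->.
- exact: setSD.
move=> x; rewrite !inE => /andP[xi xE]; rewrite xi /= rG rx; exact: fG.
Qed.

Lemma rank_setD1_above F G i : i \in F -> r (F :\ i) = r F -> F \subset G -> r (G :\ i) = r G.
Proof.
move=> iF rF FG; have := rank_setU_eq rM (G :\ i) (subD1set F i) rF.
rewrite (setUidPr (setSD _ FG)) => ->; congr (r _); apply/setP => x; rewrite !inE.
case: eqVneq => [->|_] /=; first by rewrite iF (subsetP FG).
by case xF: (x \in F); rewrite // (subsetP FG).
Qed.

(** When [i] lies in the closure of [F :\ i], removing [i] is a rank-preserving bijection between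
    the flats above [F] and those above [F :\ i] in the deletion. *)
Lemma chowpoly_delete_dependent E F i : flat_in r E F -> i \in F -> r (F :\ i) = r F ->
  chowpoly (E :\ i) (F :\ i) = chowpoly E F.
Proof.
elim: {F}_.+1 {-2}F (ltnSn #|E :\: F|) => // k IH F cF fF iF rF.
have iE := subsetP (flat_in_sub fF) _ iF.
rewrite chowpolyE [RHS]chowpolyE; congr (1 + _).
rewrite (reindex_onto (fun G => G :\ i) (fun G => i |: G)) /=; last first.
  move=> G /andP[/flat_in_sub/subsetP GE _]; apply: setU1K.
  by apply/negP => /GE; rewrite !inE eqxx.
apply: eq_big => [G|G].
  apply/idP/idP => [/andP[/andP[fG FG] /eqP iG]|/andP[fG FG]].
    have {}iG : i \in G by rewrite -iG setU11.
    have FsG : F \subset G by rewrite -(setD1K iF) -(setD1K iG) setUS ?proper_sub.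
    rewrite -(flat_in_delete iE iG (rank_setD1_above iF rF FsG)) fG properEneq FsG andbT.
    by apply: contraTneq FG => ->; rewrite properxx.
  have FsG := proper_sub FG; have iG := subsetP FsG i iF.
  rewrite (flat_in_delete iE iG (rank_setD1_above iF rF FsG)) fG setD1K // eqxx andbT.
  rewrite properEneq setSD // andbT; apply: contraTneq FG => e.
  by rewrite -(setD1K iF) -(setD1K iG) e properxx.
move=> /andP[/andP[fG FG] /eqP iG].
have {}iG : i \in G by rewrite -iG setU11.
have FsG : F \subset G by rewrite -(setD1K iF) -(setD1K iG) setUS ?proper_sub.
have rG := rank_setD1_above iF rF FsG.
rewrite rG rF IH //; last by rewrite -(flat_in_delete iE iG rG).
rewrite -ltnS; apply: leq_trans cF; rewrite ltnS; apply: cardsD_proper.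
  by rewrite (flat_in_delete iE iG rG) in fG; apply: flat_in_sub fG.
by rewrite properEneq FsG andbT; apply: contraTneq FG => ->; rewrite properxx.
Qed.

Section At.
Variables (E : {set 'I_n}) (i : 'I_n).
Hypothesis iE : i \in E.

Definition del_flat G := [&& flat_in r E G, i \notin G & flat_in r E (i |: G)].

Lemma del_flat_rank G : del_flat G -> r (i |: G) = (r G).+1.
Proof.
case/and3P=> /flat_inP[_ fG] iG _; apply/eqP.
by rewrite eqn_leq rank_setU1 // fG.
Qed.

Lemma flat_in_setD1_notin F : flat_in r E F -> i \notin F -> flat_in r (E :\ i) F.
Proof.
case/flat_inP=> FE fF iF; apply/flat_inP; split=> [|x]; first by rewrite subsetD1 FE.
by rewrite !inE => /andP[_]; apply: fF.
Qed.

Lemma flat_in_setD1P F :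
  flat_in r (E :\ i) F && (r (i |: F) != r F) = flat_in r E F && (i \notin F).
Proof.
apply/andP/andP => [[/flat_inP[FE fF] ri]|[fF iF]].
  have iF : i \notin F by apply/negP => /(subsetP FE); rewrite !inE eqxx.
  split=> //; apply/flat_inP; split; first by apply: subset_trans FE (subD1set _ _).
  move=> x xE xF; have [->|xi] := eqVneq x i; last by apply: fF; rewrite // !inE xi.
  by rewrite ltn_neqAle eq_sym ri rank_mono ?subsetUr.
split; first exact: flat_in_setD1_notin.
by case/flat_inP: fF => _ /(_ i iE iF); rewrite ltn_neqAle eq_sym => /andP[].
Qed.

Lemma del_flat_setD1 F : i \in F ->
  flat_in r E F && (r (F :\ i) != r F) = del_flat (F :\ i).
Proof.
move=> iF; rewrite /del_flat setD1K // !inE eqxx /=.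
case: (boolP (flat_in r E F)) => [/= fF|]; last by rewrite andbF.
rewrite andbT; apply/idP/idP => [rF|/flat_inP[_ /(_ i iE)]]; last first.
  by rewrite !inE eqxx setD1K // ltn_neqAle => /(_ isT)/andP[].
have [FE fF'] := flat_inP _ _ _ fF.
apply/flat_inP; split; first exact: subset_trans (subD1set _ _) FE.
move=> x xE; rewrite !inE negb_and negbK => /predU1P[->|xF].
  by rewrite setD1K // ltn_neqAle rF rank_mono ?subD1set.
rewrite ltn_neqAle rank_mono ?subsetUr // andbT; apply/eqP => e.
have := rank_setU_eq rM [set i] (subsetUr [set x] (F :\ i)) e.
rewrite -setUA ![_ :\ i :|: _]setUC setD1K // => e'.
by have := fF' x xE xF; rewrite -e' ltnn.
Qed.

(** The difference of [chowpoly_flat_sum] for [E] and for [E :\ i]. Flats of [E] avoid [i], contain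
    it as a coloop, or contain it dependently; flats of [E :\ i] span [i] or not. *)
Lemma chowpoly_delete_sum C : flat_in r E C -> i \notin C ->
  \sum_(F : {set 'I_n} | flat_in r E F && (C \subset F) && (i \notin F))
     ('X^(r F - r C) - 'X) * (chowpoly E F - chowpoly (E :\ i) F) +
  \sum_(G : {set 'I_n} | del_flat G && (C \subset G))
     ('X^((r G).+1 - r C) - 'X) * chowpoly E (i |: G) = 0.
Proof.
move=> fC iC; have fC' := flat_in_setD1_notin fC iC.
have := chowpoly_flat_sum R rM fC; rewrite -(chowpoly_flat_sum R rM fC').
rewrite (bigID (fun F : {set 'I_n} => i \notin F)) /=.
rewrite (bigID (fun F : {set 'I_n} => r (F :\ i) != r F) (fun F => _ && ~~ ~~ _)) /=.
rewrite [RHS](bigID (fun F : {set 'I_n} => r (i |: F) != r F)) /=.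
set A1 := \sum_(_ | _) _; set A2 := \sum_(_ | _) _; set A3 := \sum_(_ | _) _.
set B1 := \sum_(_ | _) _; set B2 := \sum_(_ | _) _.
(* Flats containing [i] dependently match the flats of [E :\ i] that span [i], and these terms
   cancel. *)
have -> : A3 = B2.
  rewrite /B2 (reindex_onto (fun G => G :\ i) (fun G => i |: G)) /=; last first.
    move=> G /andP[/andP[/flat_in_sub/subsetP GE _] _]; apply: setU1K.
    by apply/negP => /GE; rewrite !inE eqxx.
  apply: eq_big => F.
    rewrite negbK negbK; case: (boolP (i \in F)) => iF; last first.
      rewrite andbF /=; apply/esym/negbTE; apply: contra iF => /andP[_ /eqP <-].
      exact: setU11.
    rewrite setD1K // eqxx !andbT negbK.
    rewrite subsetD1 iC andbT [r F == _]eq_sym.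
    case: eqP => [rF|_]; last by rewrite !andbF.
    by rewrite flat_in_delete.
  move=> /andP[/andP[/andP[fF CF] /negPn iF] /negPn/eqP rF].
  by rewrite rF chowpoly_delete_dependent.
have -> : A2 = \sum_(G : {set 'I_n} | del_flat G && (C \subset G))
     ('X^((r G).+1 - r C) - 'X) * chowpoly E (i |: G).
  rewrite [RHS](reindex_onto (fun G => G :\ i) (fun G => i |: G)) /=; last first.
    by move=> G /andP[/and3P[_ iG _] _]; apply: setU1K.
  apply: eq_big => F.
    rewrite negbK; case: (boolP (i \in F)) => iF; last first.
      rewrite andbF /=; apply/esym/negbTE; apply: contra iF => /andP[_ /eqP <-].
      exact: setU11.
    rewrite setD1K // eqxx !andbT -del_flat_setD1 // subsetD1 iC andbT.
    by rewrite andbAC.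
  move=> /andP[/andP[/andP[fF CF] /negPn iF] rF].
  by rewrite -(del_flat_rank (G := F :\ i)) ?setD1K // -del_flat_setD1 // fF.
have -> : B1 = \sum_(F : {set 'I_n} | flat_in r E F && (C \subset F) && (i \notin F))
     ('X^(r F - r C) - 'X) * chowpoly (E :\ i) F.
  by apply: eq_bigl => F; rewrite andbAC flat_in_setD1P andbAC.
move=> e; rewrite (eq_bigr _ (fun F _ => mulrBr _ _ _)) sumrB -/A1.
move: e; set B := \sum_(_ | _) _ * chowpoly (E :\ i) _.
rewrite addrA => /addIr e; rewrite addrAC e subrr //.
Qed.

(** This is [chowpoly_flat_sum] for the interval from [C] to [G], with both end terms taken out. *)
Lemma chowpoly_interval_sum C G : flat_in r E G -> flat_in r E C -> C \proper G ->
  \sum_(F : {set 'I_n} | flat_in r E F && (C \proper F) && (F \proper G))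
     ('X^(r F - r C) - 'X) * chowpoly G F =
  (1 - 'X) - (1 - 'X) * chowpoly G C - ('X^(r G - r C) - 'X).
Proof.
move=> fG fC CG; have CsG := proper_sub CG.
have fCG : flat_in r G C by rewrite (flat_in_trans rM fG).
rewrite -[X in _ = X - _ - _](chowpoly_flat_sum R rM fCG).
rewrite [in RHS](bigD1 C) ?fCG ?subxx //= subnn expr0.
have GC : G != C by apply: contraTneq CG => ->; rewrite properxx.
rewrite [in RHS](bigD1 G) /=; last by rewrite flat_in_refl CsG GC.
rewrite chowpoly_refl; set S := (X in _ = _ + (_ + X) - _ - _).
transitivity S; last by ring.
apply: eq_bigl => F; apply/idP/idP => [/andP[/andP[fF CF] FG]|].
  rewrite (flat_in_trans rM fG (proper_sub FG)) fF proper_sub //=.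
  apply/andP; split; first by apply: contraTneq CF => ->; rewrite properxx.
  by apply: contraTneq FG => ->; rewrite properxx.
move=> /andP[/andP[/andP[fF CF] FC] FG]; have FsG := flat_in_sub fF.
by rewrite -(flat_in_trans rM fG FsG) fF !properEneq CF FsG FG eq_sym FC.
Qed.

(** Induction from the top: [chowpoly_delete_sum] isolates the difference at [C], multiplied by
    [1 - 'X], which can be cancelled in a domain. *)
Lemma chowpoly_delete C : flat_in r E C -> i \notin C ->
  chowpoly E C = chowpoly (E :\ i) C +
    'X * \sum_(G : {set 'I_n} | del_flat G && (C \proper G))
           chowpoly G C * chowpoly E (i |: G).
Proof.
elim: {C}_.+1 {-2}C (ltnSn #|E :\: C|) => // k IH C cC fC iC.
apply/eqP; rewrite addrC -subr_eq; apply/eqP.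
apply: (@mulfI _ (1 - 'X)).
  by rewrite -opprB oppr_eq0 polyXsubC_eq0.
have := chowpoly_delete_sum fC iC.
rewrite (bigD1 C) ?fC ?iC ?subxx //= subnn expr0 -addrA => /eqP.
rewrite addr_eq0 => /eqP ->.
(* The term [G = C] drops out because its factor is ['X^1 - 'X]. *)
have -> : \sum_(G : {set 'I_n} | del_flat G && (C \subset G))
     ('X^((r G).+1 - r C) - 'X) * chowpoly E (i |: G) =
   \sum_(G : {set 'I_n} | del_flat G && (C \proper G))
     ('X^((r G).+1 - r C) - 'X) * chowpoly E (i |: G).
  rewrite big_mkcond [RHS]big_mkcond; apply: eq_bigr => G _.
  rewrite properEneq eq_sym; case: eqVneq => /= [->|_]; last by [].
  rewrite andbF subSnn.
  by rewrite subrr mul0r if_same.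
(* The induction hypothesis expands each difference over flats [G] above [F]; after exchanging the
   sums, the inner one is [chowpoly_interval_sum]. *)
have -> : \sum_(F : {set 'I_n} | flat_in r E F && (C \subset F) && (i \notin F) && (F != C))
     ('X^(r F - r C) - 'X) * (chowpoly E F - chowpoly (E :\ i) F) =
   \sum_(G : {set 'I_n} | del_flat G && (C \proper G))
     'X * ((1 - 'X) - (1 - 'X) * chowpoly G C - ('X^(r G - r C) - 'X)) * chowpoly E (i |: G).
  transitivity (\sum_(F : {set 'I_n} | flat_in r E F && (C \subset F) && (i \notin F) && (F != C))
     \sum_(G : {set 'I_n} | del_flat G && (F \proper G))
        'X * (('X^(r F - r C) - 'X) * chowpoly G F) * chowpoly E (i |: G)).
    apply: eq_bigr => F /andP[/andP[/andP[fF CF] iF] FC].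
    have CpF : C \proper F by rewrite properEneq eq_sym FC.
    rewrite IH //; last exact: (leq_trans (cardsD_proper (flat_in_sub fF) CpF) cC).
    by rewrite addrAC subrr add0r mulrCA !mulr_sumr; apply: eq_bigr => G _; rewrite !mulrA.
  rewrite (exchange_big_dep (fun G => del_flat G && (C \proper G))) /=; last first.
    move=> F G /andP[/andP[/andP[_ CF] _] _] /andP[-> FG]; exact: sub_proper_trans FG.
  apply: eq_bigr => G /andP[dG CG]; have /and3P[fG iG _] := dG.
  rewrite -(chowpoly_interval_sum fG fC CG) mulr_sumr mulr_suml.
  apply: eq_bigl => F; rewrite dG /= [in RHS]properEneq eq_sym.
  case: (boolP (F \proper G)) => FG; last by rewrite !andbF.
  rewrite !andbT; have -> : i \notin F by apply: contra iG; apply/subsetP/proper_sub.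
  by rewrite andbT [RHS]andbCA andbC.
rewrite -big_split /= -sumrN mulrCA !mulr_sumr; apply: eq_bigr => G /andP[dG CG].
rewrite subSn ?rank_mono ?proper_sub // exprS; ring.
Qed.
End At.
End Deletion.

(** * Central moments *)

Section Moments.
Variable R : realFieldType.
Implicit Types (p q : {poly R}) (c : R).

(** Unnormalised: dividing by [p.[1]] gives the moment about [c] of the random variable weighted by
    the coefficients. This keeps it linear in [p]. *)
Definition moment c j p := \sum_(i < size p) p`_i * (i%:R - c) ^+ j.

Lemma moment_widen m c j p : (size p <= m)%N ->
  moment c j p = \sum_(i < m) p`_i * (i%:R - c) ^+ j.
Proof.
move=> le; rewrite /moment (big_ord_widen m (fun i => p`_i * (i%:R - c) ^+ j) le).
rewrite big_mkcond; apply: eq_bigr => i _; case: ltnP => // /(nth_default 0) ->.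
by rewrite mul0r.
Qed.

Lemma momentD c j p q : moment c j (p + q) = moment c j p + moment c j q.
Proof.
have [sp sq] := (leq_maxl (size p) (size q), leq_maxr (size p) (size q)).
rewrite (moment_widen _ _ (size_polyD p q)) (moment_widen _ _ sp) (moment_widen _ _ sq).
by rewrite -big_split /=; apply: eq_bigr => i _; rewrite coefD mulrDl.
Qed.

Lemma momentZ c j a p : moment c j (a *: p) = a * moment c j p.
Proof.
rewrite (moment_widen _ _ (size_scale_leq a p)) mulr_sumr.
by apply: eq_bigr => i _; rewrite coefZ mulrA.
Qed.

Lemma moment0 c j : moment c j 0 = 0.
Proof. by rewrite /moment size_poly0 big_ord0. Qed.

Lemma moment_sum c j (I : Type) (s : seq I) (P : pred I) (F : I -> {poly R}) :
  moment c j (\sum_(i <- s | P i) F i) = \sum_(i <- s | P i) moment c j (F i).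
Proof. exact: (big_morph _ (momentD c j) (moment0 c j)). Qed.

Lemma momentXn c j m : moment c j 'X^m = (m%:R - c) ^+ j.
Proof.
rewrite (moment_widen c j (m := m.+1)) ?size_polyXn // big_ord_recr /= big1 => [|i _].
  by rewrite coefXn eqxx mul1r add0r.
by rewrite coefXn ltn_eqF // mul0r.
Qed.

Lemma moment_eq0 c p : moment c 0 p = p.[1].
Proof.
rewrite horner_coef; apply: eq_bigr => i _; by rewrite expr0 expr1n.
Qed.

Lemma momentM a b j p q : moment (a + b) j (p * q) =
  \sum_(i < j.+1) 'C(j, i)%:R * moment a i p * moment b (j - i) q.
Proof.
have polyE (u : {poly R}) : u = \sum_(i < size u) u`_i *: 'X^i.
  by rewrite -poly_def coefK.
rewrite {1}(polyE p) {1}(polyE q) mulr_suml moment_sum.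
under eq_bigr => i _ do rewrite mulr_sumr moment_sum.
transitivity (\sum_(i < size p) \sum_(k < size q) \sum_(l < j.+1)
   'C(j, l)%:R * (p`_i * (i%:R - a) ^+ l) * (q`_k * (k%:R - b) ^+ (j - l))).
  apply: eq_bigr => i _; apply: eq_bigr => k _.
  rewrite -scalerAl -scalerAr scalerA -exprD momentZ momentXn natrD.
  rewrite (_ : _ - _ = (k%:R - b) + (i%:R - a)); last by ring.
  rewrite exprDn mulr_sumr; apply: eq_bigr => l _; rewrite -mulr_natl; ring.
under eq_bigr => i _ do rewrite exchange_big.
rewrite exchange_big; apply: eq_bigr => l _.
rewrite /moment -mulrA big_distrlr mulr_sumr; apply: eq_bigr => i _ /=.
rewrite mulr_sumr; apply: eq_bigr => k _; ring.
Qed.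

Lemma momentXM c j p : moment (c + 1) j ('X * p) = moment c j p.
Proof.
rewrite addrC momentM big_ord_recl big1 => [|i _].
  by rewrite addr0 bin0 subn0 mul1r -['X]expr1 momentXn expr0 mul1r.
by rewrite -['X]expr1 momentXn subrr /= /bump /= expr0n mulr0 mul0r.
Qed.

(** The trace of Poincaré duality: coefficients symmetric about [c] have this property, which passes
    to products with the centres added. *)
Definition odd_moments_vanish c p := forall j, odd j -> moment c j p = 0.

Lemma odd_moments_vanishM a b p q : odd_moments_vanish a p -> odd_moments_vanish b q ->
  odd_moments_vanish (a + b) (p * q).
Proof.
move=> pa qb j oj; rewrite momentM big1 // => i _.
have [oi|ei] := boolP (odd i); first by rewrite pa // mulr0 mul0r.
by rewrite qb ?mulr0 // oddB ?oj ?(negPf ei) // -ltnS.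
Qed.

Definition nneg_coefs p := forall i, 0 <= p`_i.

Lemma moment_even_ge0 c j p : nneg_coefs p -> ~~ odd j -> 0 <= moment c j p.
Proof.
by move=> p0 ej; apply: sumr_ge0 => i _; rewrite mulr_ge0 // exprn_even_ge0.
Qed.

(** * Positivity and centring of Chow polynomials *)

Section ChowPolyMoments.
Variables (n : nat) (r : {set 'I_n} -> nat).
Hypothesis rM : is_matroid r.
Implicit Types C E F G : {set 'I_n}.
Local Notation chowpoly := (chowpoly R r).

Lemma chowpoly_nneg E C : nneg_coefs (chowpoly E C).
Proof.
elim: {C}_.+1 {-2}C (ltnSn #|E :\: C|) => // k IH C cC m; rewrite chowpolyE.
rewrite coefD addr_ge0 ?coef1 ?ler0n // coef_sum sumr_ge0 // => F /andP[/flat_in_sub FE CF].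
rewrite coefM sumr_ge0 // => i _; rewrite mulr_ge0 //.
  by rewrite coef_sum sumr_ge0 // => j _; rewrite coefXn ler0n.
by apply: IH; exact: (leq_trans (cardsD_proper FE CF) cC).
Qed.

Lemma chowpoly_total_ge1 E C : 1 <= (chowpoly E C).[1].
Proof.
rewrite chowpolyE hornerD hornerE lerDl horner_sum sumr_ge0 // => F _.
rewrite hornerM mulr_ge0 // -(moment_eq0 0) moment_even_ge0 //; last exact: chowpoly_nneg.
move=> i; rewrite coef_sum sumr_ge0 // => j _; by rewrite coefXn ler0n.
Qed.

Lemma lt_addS (a b : nat) : (a < b)%N -> {c | b = (a + c.+1)%N}.
Proof. by move=> ab; exists (b - a).-1; lia. Qed.

Lemma del_flat_ranks E C G i : i \in E -> flat_in r E C ->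
  del_flat r E i G -> C \proper G -> G != E :\ i ->
  [/\ (r C < r G)%N, (r (i |: G) < r E)%N & r (i |: G) = (r G).+1].
Proof.
move=> iE fC dG CG GE; have /and3P[fG iG fiG] := dG.
split; last exact: del_flat_rank dG.
  exact: (flat_in_lt rM fC CG (flat_in_sub fG)).
apply: (flat_in_lt rM fiG) => //; rewrite properEneq (flat_in_sub fiG) andbT.
by apply: contra_neq GE => <-; rewrite setU1K.
Qed.

Lemma subset_rank_lt d E C : r E = (r C + d.+1)%N -> exists2 i, i \in E & i \notin C.
Proof.
move=> rEC; apply/subsetPn; apply/negP => EC.
by have := rank_mono rM EC; rewrite rEC; clear; lia.
Qed.

Lemma cardsD_setD1 E C i : i \in E -> i \notin C -> (#|(E :\ i) :\: C| < #|E :\: C|)%N.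
Proof.
move=> iE iC; rewrite setDDl setUC -setDDl.
by apply: proper_card; rewrite properD1 // inE iE iC.
Qed.

Lemma del_flat_cards E C i : i \in E -> i \notin C ->
  forall G, del_flat r E i G -> C \proper G ->
    (#|G :\: C| < #|E :\: C|)%N /\ (#|E :\: (i |: G)| < #|E :\: C|)%N.
Proof.
move=> iE iC G /and3P[/flat_in_sub GE iG _] CG; split.
  apply: proper_card; apply/properP; split; first exact: setSD.
  by exists i; rewrite !inE ?iE ?iC // (negPf iG) andbF.
apply: cardsD_proper; first by rewrite subUset sub1set iE.
exact: (proper_sub_trans CG (subsetUr _ _)).
Qed.

Lemma del_flat_nonmax E i G : r (E :\ i) = r E -> del_flat r E i G -> i \in E -> G != E :\ i.
Proof.
move=> rEi /and3P[fG iG _] iE; apply: contra_eq_neq rEi => eG; rewrite neq_ltn -eG.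
by rewrite (flat_in_lt rM fG _ (subxx E)) // eG properD1.
Qed.

(** Induction through the deletion formula. In a term with factors of ranks [a.+1] and [b.+1] one
    has [d = a + b + 2], and the factor ['X] moves the centre by the missing 1. *)
Lemma chowpoly_odd_moments d E C : flat_in r E C -> r E = (r C + d.+1)%N ->
  odd_moments_vanish (d%:R / 2) (chowpoly E C).
Proof.
move: {2}_.+1 (ltnSn #|E :\: C|) => k; elim: k d E C => // k IH d E C cC fC rEC.
have [d0 j oj|d0] := posnP d.
  rewrite {}d0 in rEC *.
  rewrite (moment_widen _ _ (m := 1)) ?big_ord1; last first.
    by apply: leq_trans (size_chowpoly R rM fC) _; rewrite geq_max; lia.
  by rewrite !mul0r subrr expr0n; case: j oj => // j _; rewrite mulr0.
have CE := flat_in_sub fC.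
have [i iE iC] := subset_rank_lt rEC.
have cE := cardsD_setD1 iE iC; have cG := del_flat_cards iE iC.
have fC' := flat_in_setD1_notin fC iC.
have odd_term G : del_flat r E i G -> C \proper G -> G != E :\ i ->
    odd_moments_vanish (d%:R / 2) ('X * (chowpoly G C * chowpoly E (i |: G))).
  move=> dG CG GE; have [rCG rGE riG] := del_flat_ranks iE fC dG CG GE.
  have [c1 c2] := cG G dG CG; have /and3P[fG _ fiG] := dG.
  have fCG : flat_in r G C by rewrite (flat_in_trans rM fG (proper_sub CG)).
  have [a ea] := lt_addS rCG; have [b eb] := lt_addS rGE.
  have dab : d = (a + b + 2)%N by move: rEC eb; rewrite riG ea; clear; lia.
  have -> : d%:R / 2 = (a%:R / 2 + b%:R / 2) + 1 :> R.
    by rewrite dab !natrD; field.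
  move=> j oj; rewrite momentXM; apply: odd_moments_vanishM => //.
    exact: (IH a G C (leq_trans c1 cC) fCG ea).
  exact: (IH b E (i |: G) (leq_trans c2 cC) fiG eb).
have [rEi|rEi] := eqVneq (r (E :\ i)) (r E).
  move=> j oj; rewrite (chowpoly_delete R rM iE fC iC) momentD.
  rewrite (IH d) // ?rEi //; last exact: leq_trans cE cC.
  rewrite add0r mulr_sumr moment_sum big1 // => G /andP[dG CG]; apply: odd_term => //.
  exact: del_flat_nonmax rEi dG iE.
(* Here [i] is a coloop and the deletion has centre [d.-1%:R / 2]. The term [G = E :\ i] joins with
   it to [(1 + 'X)] times the polynomial of the deletion, and [1 + 'X] is centred at 1/2. *)
have rEi' : r E = (r (E :\ i)).+1.
  have := rank_setU1 rM i (E :\ i); rewrite setD1K // => le1.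
  have := rank_mono rM (subD1set E i); move: rEi; lia.
have fEi : flat_in r E (E :\ i).
  apply/flat_inP; split; first exact: subD1set.
  move=> x xE; rewrite !inE xE andbT negbK => /eqP->.
  by rewrite setD1K // rEi'.
have dEi : del_flat r E i (E :\ i).
  by rewrite /del_flat fEi setD1K // flat_in_refl !inE eqxx.
have CEi : C \proper E :\ i.
  rewrite properEneq subsetD1 CE iC !andbT.
  apply: contraTneq d0 => e; move: rEC; rewrite e in rEi' *; lia.
move=> j oj; rewrite (chowpoly_delete R rM iE fC iC) (bigD1 (E :\ i)) ?dEi //=.
rewrite setD1K // chowpoly_refl mulr1 mulrDr addrA -{1}[chowpoly _ C]mul1r -mulrDl.
rewrite momentD mulr_sumr moment_sum [X in _ + X]big1 ?addr0 => [|G /andP[/andP[dG CG] GE]].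
  have -> : d%:R / 2 = 1 / 2 + d.-1%:R / 2 :> R.
    by rewrite -[in LHS](prednK d0) -natr1 mulrDl addrC.
  apply: odd_moments_vanishM => //; last first.
    apply: (IH _ _ _ (leq_trans cE cC) fC').
    by move: rEC; rewrite rEi' prednK // addnS => -[].
  move=> l ol; rewrite momentD -['X]expr1 -(expr0 'X) !momentXn.
  rewrite (_ : 0%:R - _ = - (1%:R - 1 / 2)); last by field.
  by rewrite exprNn -signr_odd ol expr1 mulN1r addNr.
exact: odd_term.
Qed.
End ChowPolyMoments.
End Moments.

(** * Boolean minors *)

Section Boolean.
Variable R : idomainType.

(** Every element of [E :\: C] is a coloop of the minor given by [E] and [C]. *)
Definition boolean_on n (r : {set 'I_n} -> nat) (E C : {set 'I_n}) :=
  forall F : {set 'I_n}, C \subset F -> F \subset E -> r F = (r C + #|F :\: C|)%N.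

Lemma setUD_sub (T : finType) (C F : {set T}) : C \subset F -> C :|: (F :\: C) = F.
Proof. by move=> CF; rewrite setDE setUIr setUCr setIT; apply/setUidPr. Qed.

Lemma sum_card_subsets (V : nmodType) (T : finType) (D : {set T}) (g : nat -> V) :
  \sum_(A : {set T} | A \subset D) g #|A| = \sum_(j < #|D|.+1) g j *+ 'C(#|D|, j).
Proof.
rewrite (partition_big (fun A : {set T} => inord #|A| : 'I_#|D|.+1) xpredT) //=.
apply: eq_bigr => j _.
rewrite -cards_draws -sumr_const; apply: eq_big => [A|A]; rewrite ?inE.
  case AD: (A \subset D) => //=.
  by rewrite -val_eqE /= inordK // ltnS subset_leq_card.
by case/andP=> AD /eqP <-; rewrite inordK // ltnS subset_leq_card.
Qed.

Lemma boolean_flat n (r : {set 'I_n} -> nat) (E C F : {set 'I_n}) : boolean_on r E C ->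
  C \subset F -> F \subset E -> flat_in r E F.
Proof.
move=> rB CF FE; apply/flat_inP; split=> // x xE xF.
have CxF := subset_trans CF (subsetUr [set x] F).
have xFE : x |: F \subset E by rewrite subUset sub1set xE.
rewrite (rB F) // (rB (x |: F)) // ltn_add2l !cardsDS // cardsU1 xF add1n.
by rewrite ltn_sub2r // ltnS subset_leq_card.
Qed.

Lemma boolean_chowpoly_step n (r : {set 'I_n} -> nat) (E C : {set 'I_n}) (B : nat -> {poly R}) :
  C \subset E -> boolean_on r E C ->
  (forall F : {set 'I_n}, C \proper F -> F \subset E -> chowpoly R r E F = B #|E :\: F|) ->
  chowpoly R r E C = 1 + \sum_(j < #|E :\: C|.+1)
    (inner_powers R j * B (#|E :\: C| - j)%N) *+ 'C(#|E :\: C|, j).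
Proof.
move=> CE rB IH; rewrite chowpolyE; congr (1 + _).
rewrite -(sum_card_subsets _ (fun j => inner_powers R j * B (#|E :\: C| - j)%N)).
rewrite [RHS](bigD1 set0) ?sub0set //= cards0 {2}/inner_powers big_geq // mul0r add0r.
rewrite (reindex_onto (fun A : {set 'I_n} => C :|: A)
  (fun F : {set 'I_n} => F :\: C)) /=; last first.
  by move=> F /andP[_ CF]; rewrite setUD_sub // proper_sub.
have DE (A : {set 'I_n}) : A \subset E :\: C -> (C :|: A) :\: C = A.
  rewrite subsetD => /andP[_ dAC]; rewrite setDUl setDv set0U.
  by apply/setDidPl.
apply: eq_big => A.
  apply/idP/idP => [/andP[/andP[fA CA] /eqP eA]|/andP[AD A0]].
    rewrite -{1}eA setSD ?(flat_in_sub fA) //=.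
    by apply: contraTneq CA => ->; rewrite setU0 properxx.
  rewrite DE // eqxx andbT properEneq subsetUl andbT.
  have AE : A \subset E by apply: subset_trans AD (subsetDl _ _).
  rewrite (boolean_flat rB) ?subsetUl ?subUset ?CE //=.
  by apply: contra_neq A0 => e; rewrite -(DE A AD) -e setDv.
move=> /andP[/andP[fA CA] /eqP eA].
have CAE := flat_in_sub fA.
rewrite rB ?subsetUl // eA addKn IH // -setDDl cardsDS //.
by rewrite -{1}eA setSD.
Qed.

Definition boolean_chowpoly m : {poly R} := chowpoly R (fun A : {set 'I_m} => #|A|) setT set0.

(** [boolean_chowpoly_step] depends only on [#|E :\: C|]. The induction ranges over all [n] and [r],
    so that it serves the given minor and the standard model alike. *)
Lemma chowpoly_boolean n (r : {set 'I_n} -> nat) (E C : {set 'I_n}) :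
  C \subset E -> boolean_on r E C -> chowpoly R r E C = boolean_chowpoly #|E :\: C|.
Proof.
move: {2}_.+1 (ltnSn #|E :\: C|) => k; elim: k n r E C => // k IH n r E C cC CE rB.
have canon : boolean_on (fun A : {set 'I_#|E :\: C|} => #|A|) setT set0.
  by move=> F _ _; rewrite cards0 setD0.
have cT : #|[set: 'I_#|E :\: C|] :\: set0| = #|E :\: C| by rewrite setD0 cardsT card_ord.
rewrite (boolean_chowpoly_step CE rB (B := boolean_chowpoly)) => [|F CF FE].
  rewrite [RHS](boolean_chowpoly_step (sub0set _) canon (B := boolean_chowpoly)) ?cT // => F CF FE.
  apply: IH => //; last by move=> G FG _; rewrite -(cardsID F G) (setIidPr FG).
  apply: leq_trans (cardsD_proper FE CF) _; by rewrite cT.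
apply: IH => //; first exact: (leq_trans (cardsD_proper FE CF) cC).
move=> G FG GE; have CsF := proper_sub CF; have CG := subset_trans CsF FG.
rewrite (rB G) // (rB F) // -addnA; congr (_ + _)%N.
by rewrite -(cardsID F (G :\: C)) setIDAC (setIidPr FG) setDDl (setUidPr CsF).
Qed.
End Boolean.

(** * The moment bound for Chow polynomials *)

Section MomentBound.
Variables (R : realFieldType) (t : nat) (f : nat -> nat -> R).
Hypothesis fC : CMFS t f.
Hypothesis fB : forall d k, (k <= t)%N ->
  moment (d%:R / 2) k (boolean_chowpoly R d.+1) <= f k d * (boolean_chowpoly R d.+1).[1].

Lemma card_matroid n : is_matroid (fun A : {set 'I_n} => #|A|).
Proof.
split=> [//|A B|A B]; first exact: subset_leq_card.
by rewrite cardsUI.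
Qed.

(** The bound dominates a Boolean moment, which is zero for odd [k] and nonnegative for even [k]. *)
Lemma CMFS_bound_ge0 d k : (k <= t)%N -> 0 <= f k d.
Proof.
move=> kt; have T1 := @chowpoly_total_ge1 R _ (fun A : {set 'I_d.+1} => #|A|) setT set0.
have fl : flat_in (fun A : {set 'I_d.+1} => #|A|) setT set0.
  by apply/flat_inP; split=> [|x _ _]; rewrite ?sub0set // cardsU1 cards0 inE.
rewrite -(pmulr_lge0 _ (lt_le_trans ltr01 T1)); apply: le_trans (fB d kt).
have [ok|ek] := boolP (odd k); last exact/moment_even_ge0/ek/chowpoly_nneg.
rewrite (chowpoly_odd_moments R (card_matroid d.+1) fl _ ok) //.
by rewrite cardsT card_ord cards0.
Qed.

Section Matroid.
Variables (n : nat) (r : {set 'I_n} -> nat).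
Hypothesis rM : is_matroid r.
Implicit Types C E F G : {set 'I_n}.
Local Notation chowpoly := (chowpoly R r).

(** Submodularity for [E :\ x] and [F] passes the rank drop at [x] from [E] to every subset [F]
    containing [x]. *)
Lemma boolean_on_coloops E C : C \subset E ->
  (forall i, i \in E -> i \notin C -> (r (E :\ i) < r E)%N) -> boolean_on r E C.
Proof.
move=> CE colo F; elim: {F}_.+1 {-2}F (ltnSn #|F :\: C|) => // k IH F cF CF FE.
have [FC|/set0Pn[x]] := eqVneq (F :\: C) set0.
  rewrite FC cards0 addn0; congr r; apply/eqP; rewrite eqEsubset CF andbT.
  by rewrite -setD_eq0 FC.
rewrite inE => /andP[xC xF]; have xE := subsetP FE x xF.
have CFx : C \subset F :\ x by rewrite subsetD1 CF.
have FxE : F :\ x \subset E by apply: subset_trans (subD1set _ _) FE.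
have lt := cardsD_setD1 xF xC.
have := IH (F :\ x) (leq_trans lt cF) CFx FxE.
have -> : (F :\ x) :\: C = (F :\: C) :\ x by rewrite !setDDl setUC.
rewrite (cardsD1 x (F :\: C)) !inE xC xF add1n addnS => <-.
apply/eqP; rewrite eqn_leq -{1}(setD1K xF) rank_setU1 //=.
have := rank_submod rM (E :\ x) F; have := colo x xE xC.
have -> : (E :\ x) :|: F = E.
  apply/eqP; rewrite eqEsubset subUset subD1set FE /=.
  apply/subsetP => y yE; rewrite !inE yE andbT.
  by case: eqVneq => //= ->; rewrite xF.
rewrite setIDAC (setIidPr FE).
by move: (r (E :\ x)) (r E) (r F) (r _); clear; lia.
Qed.

(** The binomial expansion is compared term by term with the CMFS sum. Terms with an odd index
    vanish and the bounds are nonnegative; in the others all factors are nonnegative, so bounds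
    multiply. *)
Lemma product_moment_bound a b k p q : (k <= t)%N -> nneg_coefs p -> nneg_coefs q ->
  odd_moments_vanish (a%:R / 2) p -> odd_moments_vanish (b%:R / 2) q ->
  (forall i, (i <= t)%N -> moment (a%:R / 2) i p <= f i a * p.[1]) ->
  (forall i, (i <= t)%N -> moment (b%:R / 2) i q <= f i b * q.[1]) ->
  moment (a%:R / 2 + b%:R / 2) k (p * q) <= f k (a + b + 2)%N * (p * q).[1].
Proof.
move=> kt p0 q0 op oq bp bq.
have P0 : 0 <= p.[1] by rewrite -(moment_eq0 0) moment_even_ge0.
have Q0 : 0 <= q.[1] by rewrite -(moment_eq0 0) moment_even_ge0.
rewrite momentM hornerM.
apply: le_trans (ler_wpM2r (mulr_ge0 P0 Q0) (proj2 fC a b k kt)).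
rewrite mulr_suml; apply: ler_sum => i _.
have it : (i <= t)%N by apply: leq_trans kt; rewrite -ltnS.
have kit : (k - i <= t)%N by apply: leq_trans (leq_subr _ _) kt.
rewrite -!mulrA ler_wpM2l ?ler0n //.
rewrite (_ : _ * (_ * (p.[1] * q.[1])) = (f i a * p.[1]) * (f (k - i)%N b * q.[1])); last by ring.
have r0 : 0 <= (f i a * p.[1]) * (f (k - i)%N b * q.[1]).
  by rewrite !mulr_ge0 ?CMFS_bound_ge0.
have [oi|ei] := boolP (odd i); first by rewrite op // mul0r.
have [ok|ek] := boolP (odd (k - i)); first by rewrite oq // mulr0.
by rewrite ler_pM ?moment_even_ge0 ?bp ?bq.
Qed.

(** Both sides are additive in the polynomial, so the bound can be checked on each summand of the
    deletion formula at a non-coloop; if there is none, the minor is Boolean. *)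
Lemma chowpoly_moment_bound d E C k : flat_in r E C -> r E = (r C + d.+1)%N -> (k <= t)%N ->
  moment (d%:R / 2) k (chowpoly E C) <= f k d * (chowpoly E C).[1].
Proof.
move: {2}_.+1 (ltnSn #|E :\: C|) => s; elim: s d E C k => // s IH d E C k cC fE rEC kt.
have CE := flat_in_sub fE.
have [/existsP[i /and3P[iE iC /eqP rEi]]|nodep] :=
    boolP [exists i, [&& i \in E, i \notin C & r (E :\ i) == r E]]; last first.
  have rB : boolean_on r E C.
    apply: boolean_on_coloops => // i iE iC; rewrite ltn_neqAle rank_mono ?subD1set // andbT.
    by apply: contra nodep => e; apply/existsP; exists i; rewrite iE iC.
  rewrite chowpoly_boolean //; have := rB E CE (subxx E); rewrite rEC => /addnI <-.
  exact: fB.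
have cE := cardsD_setD1 iE iC; have cG := del_flat_cards iE iC.
rewrite (chowpoly_delete R rM iE fE iC) momentD hornerD mulrDr lerD //.
  by apply: IH => //; [exact: leq_trans cE cC|exact: flat_in_setD1_notin|rewrite rEi].
rewrite mulr_sumr moment_sum horner_sum mulr_sumr; apply: ler_sum => G /andP[dG CG].
(* Since [i] is not a coloop, [G] is not [E :\ i]; hence both factors have positive rank and [a],
   [b] below exist. *)
have GE := del_flat_nonmax rM rEi dG iE.
have [rCG rGE riG] := del_flat_ranks rM iE fE dG CG GE.
have [c1 c2] := cG _ G dG CG; have /and3P[fG _ fiG] := dG.
have fCG : flat_in r G C by rewrite (flat_in_trans rM fG (proper_sub CG)).
have [a ea] := lt_addS rCG; have [b eb] := lt_addS rGE.
have dab : d = (a + b + 2)%N by move: rEC eb; rewrite riG ea; clear; lia.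
have -> : d%:R / 2 = (a%:R / 2 + b%:R / 2) + 1 :> R.
  by rewrite dab !natrD; field.
rewrite momentXM [in leRHS]hornerM hornerX mul1r dab.
apply: product_moment_bound => //.
- exact: chowpoly_nneg.
- exact: chowpoly_nneg.
- exact: chowpoly_odd_moments.
- exact: chowpoly_odd_moments.
- by move=> l lt; apply: IH => //; exact: leq_trans c1 cC.
- by move=> l lt; apply: IH => //; exact: leq_trans c2 cC.
Qed.
End Matroid.
End MomentBound.

(** * From Chow polynomials to moments of the Chow ring *)

Section Conclusion.
Variables (R : realFieldType) (n : nat) (r : {set 'I_n} -> nat) (d : nat).
Hypotheses (rM : is_matroid r) (rL : loopless r) (rd : r setT = d.+1).

Lemma chow_dim_chowpoly k : (chow_dim r k)%:R = (chowpoly R r setT set0)`_k.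
Proof.
have [i0 _] : exists i : 'I_n, i \in [set: 'I_n].
  apply/set0Pn; apply: contra_eq_neq rd => ->; by rewrite rank_set0.
by rewrite (chow_dim_count rM rL i0) count_fy_seq.
Qed.

Lemma flat_in_set0 : flat_in r setT set0.
Proof. by rewrite flat_inT loopless_flat0. Qed.

Lemma chow_moment_chowpoly k : chow_moment R r d k =
  moment (d%:R / 2) k (chowpoly R r setT set0) / (chowpoly R r setT set0).[1].
Proof.
have size_le : (size (chowpoly R r setT set0) <= d.+1)%N.
  have := size_chowpoly R rM flat_in_set0.
  by rewrite rank_set0 // subn0 rd (maxnSS 0) max0n.
rewrite /chow_moment (moment_widen _ _ size_le) -(moment_eq0 0) (moment_widen _ _ size_le).
by congr (_ / _); apply: eq_bigr => i _; rewrite chow_dim_chowpoly ?expr0 ?mulr1.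
Qed.
End Conclusion.

Lemma boolean_rank_loopless d : loopless (@boolean_rank d).
Proof. by move=> i; rewrite /boolean_rank cards1. Qed.

Theorem theorem3p3 (R : realFieldType) (t : nat) (f : nat -> nat -> R) :
  CMFS t f ->
  (forall d k, (k <= t)%N -> boolean_moment R d k <= f k d) ->
  forall (n : nat) (r : {set 'I_n} -> nat) (d : nat),
    is_matroid r -> loopless r -> r setT = d.+1 ->
    chow_moment R r d t <= f t d.
Proof.
move=> fC fB n r d rM rL rd.
(* The Boolean hypothesis with its denominator cleared, the total being at least 1. *)
have fB' e k : (k <= t)%N ->
    moment (e%:R / 2) k (boolean_chowpoly R e.+1) <= f k e * (boolean_chowpoly R e.+1).[1].
  move=> kt; have := fB e k kt; rewrite /boolean_moment chow_moment_chowpoly.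
  - by rewrite ler_pdivrMr //; apply: (lt_le_trans ltr01 (chowpoly_total_ge1 _ _ _ _)).
  - exact: card_matroid.
  - exact: boolean_rank_loopless.
  - by rewrite /boolean_rank cardsT card_ord.
rewrite chow_moment_chowpoly // ler_pdivrMr; last first.
  exact: (lt_le_trans ltr01 (chowpoly_total_ge1 _ _ _ _)).
apply: (chowpoly_moment_bound fC fB' rM) => //; first exact: flat_in_set0.
by rewrite rank_set0.
Qed.
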